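(* Let $\mathcal{CL}\subset\mathbb{P}^2_{\mathbb{C}}$ be an arrangement of $k\geq 1$ smooth conics and $d\geq 3$ lines all of whose singularities are ordinary of multiplicity at most $4$. Assume that $\mathcal{CL}$ is an $\mathscr{M}$-arrangement. For $r\in\{2,3,4\}$ let $n_r$ denote the number of points of $\mathbb{P}^2_{\mathbb{C}}$ lying on exactly $r$ curves of $\mathcal{CL}$. (i) If $d=2\ell$ for some $\ell\geq 2$, then $n_2+2n_3+3n_4=(k+\ell)^2+\ell-k-3$. (ii) If $d=2\ell+1$ for some $\ell\geq 1$, then $n_2+2n_3+3n_4=(k+\ell)^2+2\ell-1$.
   Context: An arrangement of conics and lines is a finite set of pairwise distinct smooth conics and lines in $\mathbb{P}^2_{\mathbb{C}}$, identified with the reduced curve $\{f=0\}$ that is their union; its degree is $2k+d$. A singular point of this curve is ordinary of multiplicity $r$ if exactly $r$ curves of the arrangement pass through it and their tangent lines there are pairwise distinct. For a reduced curve $C=\{f=0\}$, $J_f=\langle\partial_x f,\partial_y f,\partial_z f\rangle$ is the Jacobian ideal, and $\deg J_f$ is the degree of the scheme it defines, i.e. the total Tjurina number $\tau(C)=\sum_{p\in\mathrm{Sing}(C)}\tau_p$. (An ordinary point of multiplicity $r\le 4$ has $\tau_p=(r-1)^2$.) An arrangement of degree $e\geq 5$ with only ordinary singularities of multiplicity at most $4$ is an $\mathscr{M}$-arrangement (its union is an $\mathscr{M}$-curve) if it has at least one ordinary quadruple point and $$\deg J_f=\begin{cases}3m^2-3m+3 & \text{if } e=2m\geq 6,\\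 3m^2+1 & \text{if } e=2m+1\geq 5.\end{cases}$$ *)

(* Defs.v *)
From mathcomp Require Import all_boot all_order all_algebra.
From mathcomp Require Import finmap mpoly complex.
From mathcomp Require Import boolp classical_sets functions cardinality fsbigop.
From mathcomp Require Import reals.

Set Implicit Arguments.
Unset Strict Implicit.
Unset Printing Implicit Defensive.

Import Order.TTheory GRing.Theory Num.Theory.

Local Open Scope classical_set_scope.
Local Open Scope ring_scope.

Section ConicLineArrangements.
Variable R : realType.
Local Notation C := R[i].
Local Notation form := {mpoly C[3]}.
Local Notation K := {fraction {mpoly C[3]}}.

Definition P2 := {U : {vspace 'rV[C]_3} | \dim U == 1%N}.

(* A choice of homogeneous coordinates.  All uses below concern homogeneous
   polynomials, for which neither vanishing at [p] nor the tangent line at [p]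
   depends on the choice. *)
Definition coords (p : P2) : 'I_3 -> C := vpick (val p) 0.

Definition on_curve (F : form) (p : P2) : bool := F.@[coords p] == 0.

Definition curve (F : form) : set P2 := [set p | on_curve F p].

Definition sing_locus (F : form) : set P2 :=
  [set p | on_curve F p /\ forall i : 'I_3, on_curve F^`M(i) p].

Definition smooth_conic (F : form) : Prop :=
  [/\ F != 0, F \is 2.-homog & sing_locus F = set0].

Definition line (F : form) : Prop := F != 0 /\ F \is 1.-homog.

Definition tangent_line (F : form) (p : P2) : set P2 :=
  curve (\sum_(i < 3) (F^`M(i)).@[coords p] *: 'X_i).

Record arrangement (k d : nat) := Arrangement {
  equation : 'I_k + 'I_d -> form;
  conicP : forall i : 'I_k, smooth_conic (equation (inl i));
  lineP : forall j : 'I_d, line (equation (inr j));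
  distinctP : forall s t : 'I_k + 'I_d,
    s <> t -> curve (equation s) <> curve (equation t)
}.

(* The dimension over C of V / W is n; used for C-subspaces W `<=` V of the
   field K, on which C acts through constant polynomials. *)
Definition quotient_dim (V W : set K) (n : nat) : Prop :=
  exists b : 'I_n -> K, (forall i, V (b i)) /\
    forall x, V x ->
      exists! c : 'rV[C]_n, W (x - \sum_(i < n) tofrac (c 0 i)%:MP * b i).

Definition jacobian_ideal (F : form) : set form :=
  [set G | exists a : 'I_3 -> form, G = \sum_(i < 3) a i * F^`M(i)].

(* The stalk at p of the ideal sheaf on P2 attached to a homogeneous ideal J;
   for J = setT it is the local ring of P2 at p. *)
Definition stalk (J : set form) (p : P2) : set K :=
  [set x | exists G H m, [/\ J G, G \is m.-homog, H \is m.-homog,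
     ~~ on_curve H p & x = tofrac G / tofrac H]].

(* In an affine chart around p, Euler's formula identifies this quotient with
   the Tjurina algebra O_p / (f, f_x, f_y) of a local equation f.  It is also
   the local ring at p of the scheme defined by the Jacobian ideal. *)
Definition tjurina_number (F : form) (p : P2) (n : nat) : Prop :=
  quotient_dim (stalk setT p) (stalk (jacobian_ideal F) p) n.

(* The degree of the zero-dimensional scheme defined by the Jacobian ideal,
   i.e. the sum of the lengths of its local rings (the total Tjurina
   number). *)
Definition jacobian_degree (F : form) (D : nat) : Prop :=
  finite_set (sing_locus F) /\
  exists2 tau : P2 -> nat,
    forall p, sing_locus F p -> tjurina_number F p (tau p) &
    D = (\sum_(p \in sing_locus F) tau p)%R.

Section Arrangement.
Variables k d : nat.
Implicit Type A : arrangement k d.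

Definition union_eq A : form := \prod_s equation A s.

Definition multiplicity A (p : P2) : nat :=
  #|[pred s | on_curve (equation A s) p]|.

Definition ordinary A (r : nat) (p : P2) : Prop :=
  multiplicity A p = r /\
  forall s t, s <> t ->
    on_curve (equation A s) p -> on_curve (equation A t) p ->
    tangent_line (equation A s) p <> tangent_line (equation A t) p.

Definition only_ordinary_singularities A (rmax : nat) : Prop :=
  forall p, sing_locus (union_eq A) p ->
    exists2 r, (r <= rmax)%N & ordinary A r p.

(* The number of points on exactly r curves.  Distinct curves of the
   arrangement meet in finitely many points, so for r >= 2 this set is finite
   and the default value of [fset_set] on infinite sets plays no role. *)
Definition npoints A (r : nat) : nat :=
  #|` fset_set [set p : P2 | multiplicity A p = r] |.

Definition M_degree (e : nat) : nat :=
  let m := e./2 in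
  if odd e then (3 * m ^ 2 + 1)%N else (3 * m ^ 2 - 3 * m + 3)%N.

Definition M_arrangement A : Prop :=
  [/\ (5 <= 2 * k + d)%N,
      only_ordinary_singularities A 4,
      exists p, sing_locus (union_eq A) p /\ ordinary A 4 p &
      jacobian_degree (union_eq A) (M_degree (2 * k + d))].

End Arrangement.
End ConicLineArrangements.

(* Main.v *)
(* Two curves of degrees e and m in the arrangement meet transversally at every
   common point, because those points are ordinary singularities of the union;
   hence they have exactly e * m common points.  To see it, parametrize the
   first curve rationally, with the point at infinity off the second one, and
   count the roots of a polynomial of degree e * m with simple roots.  Summing
   over ordered pairs gives
     2 (n_2 + 3 n_3 + 6 n_4) = (2k + d)^2 - (4k + d).
   On the other hand an ordinary point of multiplicity r <= 4 has Tjurina number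
   (r - 1)^2, so that deg J_f = n_2 + 4 n_3 + 9 n_4, and the left-hand side of
   the theorem is the difference of these two quantities.

   For the Tjurina number, put s = r - 2 and let P, Q be two derivatives of the
   equation transverse to the point.  Their leading forms are coprime of degree
   s + 1, so (P, Q) contains all functions of order >= 2s + 1; Euler's formula
   puts the third derivative in (P, Q) up to order s + 3 >= 2s + 1.  The ideal
   is thus determined by its jets of order < 2s + 1, where (a, b) |-> aP + bQ is
   injective on pairs of jets of order < s:
     (2s + 1)(s + 1) - s(s + 1) = (s + 1)^2. *)
From HB Require Import structures.
Require Import Defs.
From mathcomp Require Import all_boot all_order all_algebra separable.
From mathcomp Require Import finmap mpoly complex.
From mathcomp Require Import boolp classical_sets functions cardinality fsbigop.
From mathcomp Require Import reals ring zify.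

Set Implicit Arguments.
Unset Strict Implicit.
Unset Printing Implicit Defensive.

Import Order.TTheory GRing.Theory Num.Theory.
Local Open Scope ring_scope.

(** * Substitution in homogeneous polynomials *)

Section Substitution.
Variables (n : nat) (R S : comNzRingType) (f : {rmorphism R -> S}).
Implicit Types (h : 'I_n -> S) (G : {mpoly R[n]}).

Lemma mmap_homogZ h (c : S) e G :
  G \is e.-homog -> mmap f (fun i => c * h i) G = c ^+ e * mmap f h G.
Proof.
move=> /dhomogP hG; rewrite /mmap mulr_sumr !big_seq; apply: eq_bigr => m /hG me.
rewrite mulrCA; congr (_ * _); rewrite /mmap1 -me /= mdegE.
by under eq_bigr do rewrite exprMn; rewrite big_split /= prodrXr.
Qed.

(** The chain rule for any derivation that kills constants. It is applied to d/dt along a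
    parametrized curve and, in the chart of a blow-up, to the derivatives in the outer and in the
    inner variable. *)
Lemma mmap_derivation (del : {additive S -> S}) h G :
    (forall x y, del (x * y) = del x * y + x * del y) ->
    (forall c, del (f c) = 0) ->
  del (mmap f h G) = \sum_i mmap f h G^`M(i) * del (h i).
Proof.
move=> delM delC.
have del1 : del 1 = 0 by rewrite -(rmorph1 f) delC.
(* The rule is stable under products and holds for 1 and for the variables, hence for monomials;
   linearity does the rest. *)
pose Leib G := del (mmap f h G) = \sum_i mmap f h G^`M(i) * del (h i).
have LeibM G1 G2 : Leib G1 -> Leib G2 -> Leib (G1 * G2).
  rewrite /Leib => L1 L2; rewrite rmorphM delM L1 L2 mulr_suml mulr_sumr -big_split /=.
  by apply: eq_bigr => i _; rewrite mderivM rmorphD !rmorphM /=; ring.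
have Leib1 : Leib 1.
  rewrite /Leib rmorph1 del1 big1 // => i _.
  by rewrite -mpolyC1 mderivC rmorph0 mul0r.
have LeibX i : Leib 'X_i.
  rewrite /Leib mmapX mmap1U (bigD1 i) //= mderivX mnm1E eqxx /= scale1r.
  rewrite -[X in (X - _)%MM]add0m addmK mpolyX0 rmorph1 mul1r big1 ?addr0 // => j ji.
  by rewrite mderivX mnm1E eq_sym (negPf ji) scale0r rmorph0 mul0r.
elim/mpolyind: G => [|c m G _ _ IH].
  by rewrite rmorph0 raddf0 big1 // => i _; rewrite mderiv0 rmorph0 mul0r.
rewrite rmorphD raddfD IH /= mmapZ delM delC mul0r add0r.
have -> : del (mmap f h 'X_[m]) = \sum_i mmap f h ('X_[m])^`M(i) * del (h i).
  change (Leib 'X_[m]); rewrite mpolyXE_id; apply: big_ind => // i _.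
  elim: (m i) => [|k IHk]; first by rewrite expr0.
  by rewrite exprS; apply: LeibM.
rewrite mulr_sumr -big_split /=; apply: eq_bigr => i _.
by rewrite mderivD mderivZ rmorphD /= mmapZ; ring.
Qed.

End Substitution.

Section Homogeneous.
Variables (n : nat) (R : comNzRingType).
Implicit Types (G : {mpoly R[n]}).

Lemma dhomog_mderiv e i G : G \is e.-homog -> G^`M(i) \is e.-1.-homog.
Proof.
move=> /dhomogP hG; apply/dhomogP => m; rewrite mcoeff_msupp mcoeff_mderiv => nz.
have : (m + U_(i))%MM \in msupp G.
  by rewrite mcoeff_msupp; apply: contraNneq nz => ->; rewrite mul0rn.
by move=> /hG <- /=; rewrite mdegD mdeg1 addn1.
Qed.

Lemma euler_homog e G : G \is e.-homog -> \sum_i 'X_i * G^`M(i) = G *+ e.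
Proof.
move=> /dhomogP hG.
have XdX m i : 'X_i * ('X_[m])^`M(i) = 'X_[m] *+ m i :> {mpoly R[n]}.
  rewrite mderivX -scalerAr scaler_nat -mpolyXD; have [->|m0] := eqVneq (m i) 0%N.
    by rewrite !mulr0n.
  by rewrite addmC submK // lep1mP.
rewrite {2}[G]mpolyE.
under eq_bigr => i _.
  rewrite {1}[G]mpolyE raddf_sum mulr_sumr /=.
  under eq_bigr => m _ do rewrite mderivZ -scalerAr XdX.
  over.
rewrite exchange_big /= -sumrMnl !big_seq; apply: eq_bigr => m /hG <-.
by rewrite -scaler_sumr sumrMnr -mdegE scalerMnr.
Qed.

End Homogeneous.

(** * Linear algebra in dimension three *)

Section LinearAlgebra.
Variable F : fieldType.
Implicit Types (x y z p w u : 'rV[F]_3).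

Definition mx3 p w u : 'M[F]_3 := \matrix_(i < 3) [:: p; w; u]`_i.

Lemma mul_mx3 p w u y : y *m mx3 p w u = y 0 0 *: p + y 0 1 *: w + y 0 ord_max *: u.
Proof.
rewrite mulmx_sum_row !big_ord_recl big_ord0 !rowK /= addr0 !addrA.
by do 3?congr (_ + _ *: _); congr (y _ _); apply: val_inj.
Qed.

Lemma mx3_unit p w u :
    (forall a b c, a *: p + b *: w + c *: u = 0 -> [/\ a = 0, b = 0 & c = 0]) ->
  mx3 p w u \in unitmx.
Proof.
move=> free; rewrite -row_free_unit -kermx_eq0; apply/eqP/row_matrixP => i.
have := mulmx_ker (mx3 p w u); move/(congr1 (row i)); rewrite row_mul row0 mul_mx3.
move: (row i _) => y /free[y0 y1 y2]; apply/rowP => -[[|[|[|//]]] ltj]; rewrite mxE.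
- by rewrite -[RHS]y0; congr (y _ _); apply: val_inj.
- by rewrite -[RHS]y1; congr (y _ _); apply: val_inj.
- by rewrite -[RHS]y2; congr (y _ _); apply: val_inj.
Qed.

Lemma basis3P p w u :
    (forall a b c, a *: p + b *: w + c *: u = 0 -> [/\ a = 0, b = 0 & c = 0]) ->
  forall x, exists a b c, x = a *: p + b *: w + c *: u.
Proof.
move=> /mx3_unit uM x; pose y := x *m invmx (mx3 p w u).
by exists (y 0 0), (y 0 1), (y 0 ord_max); rewrite -mul_mx3 mulmxKV.
Qed.

(** The new vector goes to the middle row: [normal_form] needs the base point in row 0 and a
    direction transverse to all tangents in the last row. *)
Lemma complete_basis3 p u : (forall a b, a *: p + b *: u = 0 -> a = 0 /\ b = 0) ->
  exists w, mx3 p w u \in unitmx.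
Proof.
move=> free.
have : ~~ (1%:M <= p + u)%MS.
  apply/negP => /mxrankS; rewrite mxrank1 => le3.
  have := leq_trans le3 (mxrank_adds_leqif p u).1.
  by move/(leq_trans)/(_ (leq_add (rank_leq_row p) (rank_leq_row u))); rewrite addn1 ltnn.
case/row_subPn => i; move: (row i _) => w nw; exists w; apply: mx3_unit => a b c E.
have b0 : b = 0.
  apply/eqP; apply: contraNT nw => nzb; apply/sub_addsmxP; exists ((- (a / b))%:M, (- (c / b))%:M).
  rewrite /= !mul_scalar_mx; apply: (scalerI nzb); rewrite scalerDr !scalerA !mulrN !(mulrC b).
  rewrite !divfK // !scaleNr; apply/eqP; rewrite -subr_eq0 -E; apply/eqP.
  by rewrite opprD !opprK addrA [b *: w + _]addrC.
by move: E; rewrite b0 scale0r addr0 => /free[-> ->].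
Qed.

(* In dimension 3 a plane is the kernel of only one linear form, up to scaling. *)
Lemma plane_form_uniq (x y : 'rV[F]_3) (f g : 'cV[F]_3) :
    (forall a b, a *: x + b *: y = 0 -> a = 0 /\ b = 0) ->
    x *m f = 0 -> y *m f = 0 -> x *m g = 0 -> y *m g = 0 ->
    f != 0 -> exists c, g = c *: f.
Proof.
move=> free xf yf xg yg nzf.
pose M := col_mx x y.
have rM : \rank M = 2%N.
  apply/eqP; change (row_free M); rewrite -kermx_eq0; apply/eqP/row_matrixP => i.
  have := mulmx_ker M; move/(congr1 (row i)); rewrite row_mul row0.
  move: (row i _) => r; rewrite -[r]hsubmxK mul_row_col.
  rewrite [lsubmx r]mx11_scalar [rsubmx r]mx11_scalar !mul_scalar_mx => /free[-> ->].
  by rewrite row0 raddf0 row_mx0.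
have rf (h : 'cV[F]_3) : x *m h = 0 -> y *m h = 0 -> (h^T <= kermx M^T)%MS.
  by move=> xh yh; apply/sub_kermxP; rewrite -trmx_mul mul_col_mx xh yh col_mx0 trmx0.
have rk : \rank (kermx M^T) = 1%N by rewrite mxrank_ker mxrank_tr rM.
have sub_fg : (g^T <= f^T)%MS.
  apply: (submx_trans (rf _ xg yg)); rewrite -(geq_leqif (mxrank_leqif_sup (rf _ xf yf))).
  by rewrite rk rank_rV trmx_eq0 nzf.
by have /sub_rVP[c gE] := sub_fg; exists c; apply: trmx_inj; rewrite linearZ.
Qed.

End LinearAlgebra.

(** * Gradients of forms, and substitution of polynomials into forms *)

Section Gradient.
Variable C : comNzRingType.
Local Notation form := {mpoly C[3]}.
Implicit Types (F G : form) (v w x y : 'rV[C]_3).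

Definition gradient G v : 'cV[C]_3 := \col_i (G^`M(i)).@[v 0].

Lemma meval_homogZ G e c v : G \is e.-homog -> G.@[(c *: v) 0] = c ^+ e * G.@[v 0].
Proof.
move=> hG; rewrite -(mmap_homogZ idfun (v 0) c hG).
by apply: meval_eq => i; rewrite mxE.
Qed.

Lemma mul_gradient G e v : G \is e.-homog -> (v *m gradient G v) 0 0 = G.@[v 0] *+ e.
Proof.
move=> hG; rewrite -mevalMn -(euler_homog hG) raddf_sum /= mxE.
by apply: eq_bigr => i _; rewrite mevalM mevalXU mxE.
Qed.

Lemma gradient_homogZ G e c v :
  G \is e.-homog -> gradient G (c *: v) = c ^+ e.-1 *: gradient G v.
Proof.
by move=> hG; apply/colP => i; rewrite !mxE (meval_homogZ _ _ (dhomog_mderiv i hG)).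
Qed.

Lemma gradient_linear G v : G \is 1.-homog -> gradient G v = gradient G 0.
Proof. by move=> hG; rewrite -(scale0r v) (gradient_homogZ _ _ hG) scale1r. Qed.

Lemma meval_linear G v : G \is 1.-homog -> G.@[v 0] = (v *m gradient G 0) 0 0.
Proof. by move=> hG; rewrite -(gradient_linear v hG) (mul_gradient _ hG) mulr1n. Qed.

(** [H] is the Hessian, constant because the first derivatives of a quadratic form are linear. *)
Lemma gradient_quadratic G : G \is 2.-homog ->
  exists2 H : 'M[C]_3, H^T = H & forall v, gradient G v = H *m v^T.
Proof.
move=> hG; exists (\matrix_(i, j) (gradient G^`M(i) 0) j 0).
  by apply/matrixP => i j; rewrite !mxE mderiv_comm.
move=> v; apply/colP => i; rewrite !mxE (meval_linear v (dhomog_mderiv i hG)) mxE.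
by apply: eq_bigr => j _; rewrite !mxE mulrC.
Qed.

Lemma deriv_mmap_polyC G (phi : 'I_3 -> {poly C}) :
  (mmap polyC phi G)^`() = \sum_i mmap polyC phi G^`M(i) * (phi i)^`().
Proof.
by apply: mmap_derivation => [x y|c]; rewrite /= ?derivM ?derivC.
Qed.

Lemma horner_mmap_polyC G (phi : 'I_3 -> {poly C}) t :
  (mmap polyC phi G).[t] = G.@[fun i => (phi i).[t]].
Proof.
rewrite /mmap horner_sum mevalE; apply: eq_bigr => m _.
rewrite hornerM hornerC horner_prod; congr (_ * _).
by apply: eq_bigr => i _; rewrite horner_exp.
Qed.

Lemma size_coef_mul (p q : {poly C}) m n : (size p <= m.+1)%N -> (size q <= n.+1)%N ->
  (size (p * q)%R <= (m + n).+1)%N /\ (p * q)`_(m + n) = p`_m * q`_n.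
Proof.
move=> sp sq; split.
  apply: leq_trans (size_polyMleq _ _) _; rewrite -ltnS -addnS.
  by case: (size p + size q)%N (leq_add sp sq) => // k; rewrite addSn.
have ltm : (m < (m + n).+1)%N by rewrite ltnS leq_addr.
rewrite coefM (bigD1 (Ordinal ltm)) //= addKn big1 ?addr0 // => i.
rewrite -val_eqE /= neq_ltn => /orP[lt_im|lt_mi].
  by rewrite [q`_ _]nth_default ?mulr0 // (leq_trans sq) // ltn_subRL ltn_add2r.
by rewrite [p`_i]nth_default ?mul0r // (leq_trans sp).
Qed.

(** The coefficient in degree [e * m] is the value of [G] at the point at infinity of [phi]; if [G]
    does not vanish there, the substituted polynomial has exactly this degree. *)
Lemma size_coef_mmap_polyC G (phi : 'I_3 -> {poly C}) e m : G \is m.-homog ->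
    (forall i, (size (phi i) <= e.+1)%N) ->
  (size (mmap polyC phi G) <= (e * m).+1)%N /\
  (mmap polyC phi G)`_(e * m) = G.@[fun i => (phi i)`_e].
Proof.
move=> /dhomogP hG sphi.
have sX (i : 'I_3) k : (size (phi i ^+ k)%R <= (e * k).+1)%N /\
    (phi i ^+ k)`_(e * k) = (phi i)`_e ^+ k.
  elim: k => [|k [IH1 IH2]]; first by rewrite muln0 !expr0 size_poly1 coefC.
  by rewrite !exprS mulnS -IH2; apply: size_coef_mul.
have sm (mon : 'X_{1..3}) : (size (mmap1 phi mon) <= (e * mdeg mon).+1)%N /\
    (mmap1 phi mon)`_(e * mdeg mon) = mmap1 (fun i => (phi i)`_e) mon.
  rewrite /mmap1 mdegE big_distrr /=.
  elim/big_rec3: _ => [|i x y z _ [IH1 IH2]]; first by rewrite size_poly1 coefC.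
  have [? <-] := sX i (mon i); rewrite -IH2; exact: size_coef_mul.
split.
  rewrite /mmap big_seq; elim/big_ind: _ => [|p q sp sq|mon /hG me].
  - by rewrite size_poly0.
  - by rewrite (leq_trans (size_polyD _ _)) // geq_max sp sq.
  by rewrite mul_polyC (leq_trans (size_scale_leq _ _)) // -me; case: (sm mon).
rewrite /mmap coef_sum mevalE !big_seq; apply: eq_bigr => mon /hG me.
by rewrite coefCM -me; case: (sm mon) => _ ->.
Qed.

End Gradient.

(** * Transverse intersections of lines and conics *)

Section PlaneCurves.
Variable C : numClosedFieldType.
Local Notation form := {mpoly C[3]}.
Implicit Types (F G : form) (p v w x y u : 'rV[C]_3) (phi : 'I_3 -> {poly C}).

Lemma dhomog0_const F v : F \is 0.-homog -> F = (F.@[v 0])%:MP.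
Proof.
move=> /dhomogP hF; suff /msize1_polyC : (msize F <= 1)%N by move=> ->; rewrite mevalC.
rewrite msizeE; apply/bigmax_leqP_seq => m /hF /= -> _; exact: leqnn.
Qed.

Lemma gradient_linear_neq0 F v : F != 0 -> F \is 1.-homog -> gradient F v != 0.
Proof.
move=> nzF hF; apply: contraNneq nzF => g0; have := euler_homog hF; rewrite mulr1n => <-.
rewrite big1 // => i _; move/colP/(_ i): g0.
by rewrite (dhomog0_const v (dhomog_mderiv i hF)) !mxE => ->; rewrite mulr0.
Qed.

Definition pt phi t : 'rV[C]_3 := \row_i (phi i).[t].

Lemma meval_pt F phi t : F.@[(pt phi t) 0] = (mmap polyC phi F).[t].
Proof. by rewrite horner_mmap_polyC; apply: meval_eq => i; rewrite mxE. Qed.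

Lemma deriv_mmap_pt F phi t :
  (mmap polyC phi F)^`().[t] = (pt (fun i => (phi i)^`()) t *m gradient F (pt phi t)) 0 0.
Proof.
rewrite deriv_mmap_polyC horner_sum mxE; apply: eq_bigr => i _.
by rewrite hornerM -meval_pt !mxE mulrC.
Qed.

Lemma poly_fun_eq0 (q : {poly C}) : (forall t, q.[t] = 0) -> q = 0.
Proof.
move=> q0; apply/eqP; apply: contraT => /closed_nonrootP[t].
by rewrite rootE q0 eqxx.
Qed.

(** Restrict [F] to a coordinate line: if [F] is nonzero at its point at infinity [E 0], the
    restriction has positive degree and so a root. *)
Lemma homog_zero F e : F \is e.+1.-homog -> exists2 v : 'rV[C]_3, v != 0 & F.@[v 0] = 0.
Proof.
move=> hF; pose E k : 'rV[C]_3 := delta_mx 0 k.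
have E0 k : E k != 0 by apply/eqP => /rowP/(_ k)/eqP; rewrite !mxE !eqxx oner_eq0.
have [F0|F0] := eqVneq F.@[(E 0) 0] 0; first by exists (E 0).
pose phi i := E 0 0 i *: 'X + (E 1 0 i)%:P.
have sphi i : (size (phi i) <= 2)%N by rewrite /phi -mul_polyC size_MXaddC; case: ifP => // _;
  rewrite ltnS size_polyC leq_b1.
have [sF cF] := size_coef_mmap_polyC hF sphi.
have cF0 : (mmap polyC phi F)`_(1 * e.+1) != 0.
  apply: contraNneq F0; rewrite cF => <-; apply/eqP/meval_eq => i.
  by rewrite coefD coefZ coefX coefC mulr1 addr0.
have : size (mmap polyC phi F) != 1%N.
  by apply: contraNneq cF0 => s1; rewrite nth_default // s1 mul1n.
case/closed_rootP => t /rootP; rewrite -meval_pt => Ft; exists (pt phi t) => //.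
apply/eqP => /rowP/(_ 1)/eqP; rewrite !mxE /phi hornerD hornerZ hornerC hornerX.
by rewrite /E !mxE /= mul0r add0r oner_eq0.
Qed.

(* [p0] is the point at infinity of the parametrization. *)
Record parametrization F p0 e phi : Prop := Parametrization {
  param_size : forall i, (size (phi i) <= e.+1)%N;
  param_lead : forall i, (phi i)`_e = p0 0 i;
  param_zero : forall t, F.@[(pt phi t) 0] = 0;
  param_inj : forall c t t', pt phi t = c *: pt phi t' -> t = t';
  param_immersion : forall t a b,
    a *: pt phi t + b *: pt (fun i => (phi i)^`()) t = 0 -> a = 0 /\ b = 0;
  param_surj : forall v, v != 0 -> F.@[v 0] = 0 ->
    (exists c, v = c *: p0) \/ exists c t, v = c *: pt phi t
}.

(** Take t p0 + u, with [u] a second point of the line. *)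
Lemma line_parametrization F p0 : F != 0 -> F \is 1.-homog ->
  p0 != 0 -> F.@[p0 0] = 0 -> exists phi, parametrization F p0 1 phi.
Proof.
move=> nzF hF nzp Fp.
pose l := gradient F 0; have nzl : l != 0 by apply: gradient_linear_neq0.
have Fl v : F.@[v 0] = 0 <-> v *m l = 0.
  rewrite (meval_linear v hF); split=> [v0|->]; last by rewrite mxE.
  by apply/rowP => i; rewrite !ord1 v0 mxE.
have subl v : (v <= kermx l)%MS = (F.@[v 0] == 0).
  by apply/sub_kermxP/eqP => /Fl.
have rk : \rank (kermx l) = 2%N by rewrite mxrank_ker -mxrank_tr rank_rV trmx_eq0 nzl.
have : ~~ (kermx l <= p0)%MS.
  by apply/negP => /mxrankS; rewrite rk rank_rV nzp.
case/row_subPn => i; have := row_sub i (kermx l); rewrite subl.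
move: (row i _) => u /eqP Fu up.
have free a b : a *: p0 + b *: u = 0 -> a = 0 /\ b = 0.
  move=> ab0; have b0 : b = 0.
    apply/eqP; apply: contraNT up => nzb; apply/sub_rVP; exists (- (a / b)).
    apply: (scalerI nzb); rewrite scalerA mulrN mulrCA divff // mulr1 scaleNr.
    by apply/eqP; rewrite -subr_eq0 opprK addrC ab0.
  by split=> //; move/eqP: ab0; rewrite b0 scale0r addr0 scaler_eq0 (negPf nzp) orbF => /eqP.
pose phi i := p0 0 i *: 'X + (u 0 i)%:P.
have ptE t : pt phi t = t *: p0 + u.
  by apply/rowP => j; rewrite !mxE /phi hornerD hornerZ hornerC hornerX mulrC.
have pt'E t : pt (fun i => (phi i)^`()) t = p0.
  by apply/rowP => j; rewrite !mxE /phi derivD derivZ derivX derivC addr0 hornerZ hornerC mulr1.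
exists phi; split.
- by move=> j; rewrite /phi -mul_polyC size_MXaddC; case: ifP => // _;
  rewrite ltnS size_polyC leq_b1.
- by move=> j; rewrite coefD coefZ coefX coefC mulr1 addr0.
- by move=> t; apply/Fl; rewrite ptE mulmxDl -scalemxAl (Fl _).1 // (Fl _).1 // scaler0 addr0.
- move=> c t t'; rewrite !ptE scalerDr scalerA => /eqP; rewrite -subr_eq0 => /eqP E.
  have /free[] : (t - c * t') *: p0 + (1 - c) *: u = 0.
    by rewrite -E !scalerBl scale1r opprD addrACA.
  move=> /eqP E1 /eqP E2; move: E1 E2; rewrite !subr_eq0 => /eqP-> /eqP <-.
  by rewrite mul1r.
- move=> t a b; rewrite ptE pt'E scalerDr scalerA addrAC -scalerDl => /free[].
  by move=> + a0; rewrite a0 mul0r add0r.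
move=> v nzv Fv.
have : (v <= p0 + u)%MS.
  have sub : (p0 + u <= kermx l)%MS by rewrite addsmx_sub !subl Fp Fu eqxx.
  have : (v <= kermx l)%MS by rewrite subl Fv.
  move/submx_trans; apply; rewrite -(geq_leqif (mxrank_leqif_sup sub)) rk.
  have rp : \rank p0 = 1%N by rewrite rank_rV nzp.
  by rewrite -{1}rp rank_ltmx // ltmxE addsmxSl addsmx_sub submx_refl.
case/sub_addsmxP => -[a b] /=; rewrite [a]mx11_scalar [b]mx11_scalar !mul_scalar_mx.
move: (a 0 0) (b 0 0) => {}a {}b vE; have [b0|nzb] := eqVneq b 0.
  by left; exists a; rewrite vE b0 scale0r addr0.
by right; exists b, (a / b); rewrite ptE scalerDr scalerA mulrCA divff // mulr1.
Qed.

(** With the polar form [B], choose an isotropic [u] not orthogonal to [p0], and [w] orthogonal to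
    both. On a p0 + b w + c u the equation reads 2 a c B(p0, u) + b^2 B(w, w) = 0, and t^2 p0 + t r
    w + u solves it for a suitable [r]. *)
Lemma conic_parametrization F p0 : F \is 2.-homog ->
    (forall v, v != 0 -> F.@[v 0] = 0 -> gradient F v != 0) ->
  p0 != 0 -> F.@[p0 0] = 0 -> exists phi, parametrization F p0 2 phi.
Proof.
move=> hF smooth nzp Fp; have [H Hs gE] := gradient_quadratic hF.
pose B x y := (x *m H *m y^T) 0 0.
have BDl x y z : B (x + y) z = B x z + B y z by rewrite /B !mulmxDl mxE.
have BZl c x z : B (c *: x) z = c * B x z by rewrite /B -!scalemxAl mxE.
have BC x y : B x y = B y x.
  by rewrite /B -[in LHS](trmxK (x *m H *m y^T)) mxE !trmx_mul trmxK Hs mulmxA.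
have BDr x y z : B z (x + y) = B z x + B z y by rewrite BC BDl !(BC z).
have BZr c x z : B z (c *: x) = c * B z x by rewrite BC BZl (BC z).
have B0l z : B 0 z = 0 by rewrite /B !mul0mx mxE.
have FB v : F.@[v 0] *+ 2 = B v v by rewrite -(mul_gradient v hF) gE mulmxA.
have F0 v : F.@[v 0] = 0 <-> B v v = 0.
  rewrite -FB; split=> [->|/eqP]; first by rewrite mul0rn.
  by rewrite mulrn_eq0 => /eqP.
have nondeg v : v != 0 -> (forall x, B v x = 0) -> False.
  move=> nzv Bv; have/(_ v nzv) := smooth; rewrite F0 => /(_ (Bv v))/eqP[].
  rewrite gE; apply/colP => i; rewrite [RHS]mxE -(Bv (delta_mx 0 i)) BC /B.
  by rewrite -mulmxA -rowE [RHS]mxE.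
have Bp : B p0 p0 = 0 by apply/F0.
have [u [Bu nzb]] : exists u, B u u = 0 /\ B p0 u != 0.
  have [u' nzu'] : exists u', B p0 u' != 0.
    have : p0 *m H != 0.
      by apply/eqP => pH; apply: (nondeg p0 nzp) => x; rewrite /B pH mul0mx mxE.
    case/rV0Pn => i nzi; exists (delta_mx 0 i).
    by rewrite /B trmx_delta -colE mxE.
  (* Moving [u'] along the isotropic vector [p0] keeps its pairing with [p0], and this multiple
     cancels [B u' u']. *)
  exists (u' - (B u' u' / (2 * B p0 u')) *: p0); rewrite -scaleNr.
  rewrite !(BDl, BDr, BZl, BZr) Bp (BC u' p0) !mulr0 !addr0; split=> //.
  by field.
have Bpu : B u p0 = B p0 u := BC _ _.
pose M := row_mx (H *m p0^T) (H *m u^T).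
have [w nzw [Bwp Bwu]] : exists2 w, w != 0 & B w p0 = 0 /\ B w u = 0.
  have : kermx M != 0.
    by rewrite -mxrank_eq0 mxrank_ker subn_eq0 -ltnNge (leq_ltn_trans (rank_leq_col _)).
  case/matrix0Pn => i [j nzij]; exists (row i (kermx M)).
    by apply/eqP => /rowP/(_ j)/eqP; rewrite !mxE; apply/negP; move: nzij; rewrite !mxE.
  have : row i (kermx M) *m M = 0 by rewrite -row_mul mulmx_ker row0.
  rewrite mul_mx_row -[X in _ = X]row_mx0 => /eq_row_mx[e1 e2].
  by rewrite /B -!mulmxA e1 e2 mxE.
have Bpw : B p0 w = 0 by rewrite BC. have Buw : B u w = 0 by rewrite BC.
have Bsum x a b c : B x (a *: p0 + b *: w + c *: u) = a * B x p0 + b * B x w + c * B x u.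
  by rewrite !BDr !BZr.
have free a b c : a *: p0 + b *: w + c *: u = 0 -> [/\ a = 0, b = 0 & c = 0].
  move=> E; have := Bsum u a b c; have := Bsum p0 a b c.
  rewrite E !(BC _ 0) !B0l Bp Bu Bpu Bpw Buw !mulr0 !add0r addr0 => /esym/eqP.
  rewrite mulf_eq0 (negPf nzb) orbF => /eqP c0 /esym/eqP.
  rewrite addr0 mulf_eq0 (negPf nzb) orbF => /eqP a0.
  split=> //; move/eqP: E; rewrite a0 c0 !scale0r add0r addr0 scaler_eq0 (negPf nzw) orbF.
  by move/eqP.
have nzBw : B w w != 0.
  apply/eqP => Bw; apply: (nondeg w nzw) => x.
  by have [a [b [c ->]]] := basis3P free x; rewrite Bsum Bwp Bw Bwu !mulr0 !addr0.
(* With this scale, t^2 r^2 B(w, w) cancels the cross term 2 t^2 B(p0, u). *)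
pose r := sqrtC (- (2 * B p0 u) / B w w).
have rE : r ^+ 2 * B w w = - (2 * B p0 u) by rewrite sqrtCK divfK.
have nzr : r != 0.
  apply: contraNneq nzb => r0; move/eqP: rE; rewrite r0 expr0n mul0r eq_sym oppr_eq0 mulf_eq0.
  by rewrite pnatr_eq0.
pose phi i := p0 0 i *: 'X^2 + (r * w 0 i) *: 'X + (u 0 i)%:P.
have ptE t : pt phi t = t ^+ 2 *: p0 + (t * r) *: w + 1 *: u.
  apply/rowP => j; rewrite !mxE /phi !hornerD !hornerZ hornerC hornerX hornerXn; ring.
have pt'E t : pt (fun i => (phi i)^`()) t = (2 * t) *: p0 + r *: w + 0 *: u.
  apply/rowP => j; rewrite !mxE /phi !derivD !derivZ derivX derivC derivXn.
  rewrite !hornerD !hornerZ !hornerE; ring.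
exists phi; split.
- move=> i; rewrite /phi (leq_trans (size_polyD _ _)) // geq_max.
  rewrite (leq_trans (size_polyC_leq1 _)) // andbT.
  rewrite (leq_trans (size_polyD _ _)) // geq_max !(leq_trans (size_scale_leq _ _)) ?size_polyXn //.
  by rewrite size_polyX.
- by move=> i; rewrite !coefD !coefZ coefX coefXn coefC /= mulr1 mulr0 !addr0.
- move=> t; apply/F0; rewrite ptE Bsum !BDl !BZl Bp Bu Bwp Bwu Bpw Buw Bpu.
  rewrite -[LHS]/(_ + _ + _) !mulr0 !addr0 !add0r mul1r.
  have -> : t * r * (t * r * B w w) = t ^+ 2 * (r ^+ 2 * B w w) by ring.
  by rewrite rE; ring.
- move=> c t t'; rewrite !ptE => E.
  have /free[] : (t ^+ 2 - c * t' ^+ 2) *: p0 + (t * r - c * (t' * r)) *: w + (1 - c) *: u = 0.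
    move/eqP: E; rewrite -subr_eq0 => /eqP <-.
    by apply/rowP => j; rewrite !mxE; ring.
  move=> _ /eqP E1 /eqP E2; move: E1 E2; rewrite !subr_eq0 => /eqP E1 /eqP E2.
  by move: E1; rewrite -E2 mul1r => /(mulIf nzr).
- move=> t a b; rewrite ptE pt'E => E.
  have /free[_ + a0] : (a * t ^+ 2 + b * (2 * t)) *: p0 + (a * (t * r) + b * r) *: w + a *: u = 0.
    by rewrite -E; apply/rowP => j; rewrite !mxE; ring.
  by move=> /eqP; rewrite a0 mul0r add0r mulf_eq0 (negPf nzr) orbF => /eqP.
move=> v nzv /F0; have [a [b [c ->]]] := basis3P free v.
rewrite Bsum !BDl !BZl Bp Bu Bwp Bwu Bpw Buw Bpu.
rewrite !mulr0 !addr0 !add0r => E.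
(* The equation with [c = 0] forces b = 0 and leaves the point at infinity; otherwise b / c
   determines the parameter. *)
have [c0|nzc] := eqVneq c 0.
  move/eqP: E; rewrite c0 !mul0r mulr0 add0r addr0 !mulf_eq0 (negPf nzBw) orbF orbb => /eqP ->.
  by left; exists a; rewrite !scale0r !addr0.
right; exists c, (b / c / r); rewrite ptE !scalerDr !scalerA mulr1; congr (_ *: _ + _ *: _ + _).
  apply: (mulIf nzb); apply: (mulfI (_ : 2 != 0)); first by rewrite pnatr_eq0.
  have -> : 2 * (c * (b / c / r) ^+ 2 * B p0 u) = - (b ^+ 2 / c / r ^+ 2 * (- (2 * B p0 u))).
    by field; rewrite nzc nzr.
  rewrite -rE; apply: (mulfI nzc); apply/eqP; rewrite -subr_eq0 -E; apply/eqP.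
  by field; rewrite nzc nzr.
by field; rewrite nzc nzr.
Qed.

Definition regular F := forall v, v != 0 -> F.@[v 0] = 0 -> gradient F v != 0.

(** The case [c = 0] makes the gradient of [G] nonzero as well. *)
Definition transverse F G := forall v, v != 0 -> F.@[v 0] = 0 -> G.@[v 0] = 0 ->
  forall c, gradient G v != c *: gradient F v.

Lemma param_neq0 F p0 e phi t : parametrization F p0 e phi -> pt phi t != 0.
Proof.
move=> P; apply/eqP => p_0; have /eqP := oner_eq0 C; case.
by have [] := param_immersion (t := t) (a := 1) (b := 0) P; rewrite // p_0 scaler0 scale0r addr0.
Qed.

(** At a multiple root both gradients would annihilate the point and the velocity of [phi]. These
    are independent, so the gradients would be proportional, against transversality. *)
Lemma param_simple_root F G p0 e m phi t :
    parametrization F p0 e phi -> F \is e.-homog -> regular F -> G \is m.-homog ->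
    transverse F G ->
  G.@[(pt phi t) 0] = 0 -> (mmap polyC phi G)^`().[t] != 0.
Proof.
move=> P hF rF hG tr Gt; apply/eqP; rewrite deriv_mmap_pt => dG.
have mx0 (x : 'M[C]_1) : x 0 0 = 0 -> x = 0.
  by move=> x0; apply/matrixP => i j; rewrite !ord1 x0 mxE.
have Fphi := param_zero P; have nzpt := param_neq0 t P.
(* [F] vanishes along the whole of [phi], so its derivative along the velocity is zero too. *)
have F0 : mmap polyC phi F = 0 by apply: poly_fun_eq0 => x; rewrite -meval_pt.
have dF : pt (fun i => (phi i)^`()) t *m gradient F (pt phi t) = 0.
  by apply: mx0; rewrite -deriv_mmap_pt F0 deriv0 horner0.
have pF : pt phi t *m gradient F (pt phi t) = 0.
  by apply: mx0; rewrite (mul_gradient _ hF) Fphi mul0rn.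
have dG0 := mx0 _ dG; have pG : pt phi t *m gradient G (pt phi t) = 0.
  by apply: mx0; rewrite (mul_gradient _ hG) Gt mul0rn.
have [c E] := plane_form_uniq (param_immersion P (t := t)) pF dF pG dG0 (rF _ nzpt (Fphi t)).
by have := tr _ nzpt (Fphi t) Gt c; rewrite E eqxx.
Qed.

(** The substituted polynomial has degree exactly [e * m], since [p0] is off [G], and is separable;
    its roots give all common points, as [p0] is the only point that [phi] may miss. *)
Lemma transverse_points_param F G p0 e m phi :
    parametrization F p0 e phi -> F \is e.-homog -> regular F -> G \is m.-homog ->
    G.@[p0 0] != 0 -> transverse F G ->
  exists s : seq 'rV[C]_3, [/\ size s = (e * m)%N, uniq s,
    {in s, forall v, [/\ v != 0, F.@[v 0] = 0 & G.@[v 0] = 0]},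
    {in s &, forall v w c, v = c *: w -> v = w} &
    forall v, v != 0 -> F.@[v 0] = 0 -> G.@[v 0] = 0 -> exists2 w, w \in s & exists c, v = c *: w].
Proof.
move=> P hF rF hG nzG tr.
have [sphi lphi Fphi iphi _ surj] := P; have nzpt t := param_neq0 t P.
have [sg cg] := size_coef_mmap_polyC hG sphi.
set g := mmap polyC phi G in sg cg.
have {}cg : g`_(e * m) != 0.
  by rewrite cg; apply: contraNneq nzG => <-; apply/eqP/meval_eq => i.
have sizeg : size g = (e * m).+1.
  by apply/eqP; rewrite eqn_leq sg ltnNge; apply: contraNN cg => ?; rewrite nth_default.
have nzg : g != 0 by rewrite -size_poly_eq0 sizeg.
have sepg : separable_poly g.
  rewrite unlock; apply/Pdiv.ClosedField.coprimepP => t /rootP; rewrite -meval_pt => Gt.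
  exact: param_simple_root P hF rF hG tr Gt.
have [rs gE] := closed_field_poly_normal g.
have nzlg : lead_coef g != 0 by rewrite lead_coef_eq0.
have urs : uniq rs.
  rewrite -separable_prod_XsubC; move: sepg; rewrite gE unlock derivZ.
  by rewrite coprimepZl // coprimepZr.
have memrs t : (t \in rs) = (G.@[(pt phi t) 0] == 0).
  by rewrite meval_pt -/g gE -rootE rootZ // root_prod_XsubC.
have szrs : size rs = (e * m)%N.
  by have := sizeg; rewrite gE size_scale // size_prod_XsubC => -[].
exists [seq pt phi t | t <- rs]; split.
- by rewrite size_map.
- rewrite map_inj_uniq // => t t' E; apply: (iphi 1).
  by rewrite scale1r.
- by move=> _ /mapP[t + ->]; rewrite memrs => /eqP Gt; split.
- by move=> _ _ /mapP[t _ ->] /mapP[t' _ ->] c /iphi->.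
move=> v nzv Fv Gv; case: (surj v nzv Fv) => [[c vE]|[c [t vE]]].
  move: nzv Gv; rewrite vE (meval_homogZ _ _ hG) scaler_eq0 negb_or => /andP[nzc _] /eqP.
  by rewrite mulf_eq0 expf_eq0 (negPf nzc) andbF (negPf nzG).
exists (pt phi t); last by exists c.
apply/mapP; exists t => //; rewrite memrs; apply/eqP.
move: nzv Gv; rewrite vE (meval_homogZ _ _ hG) scaler_eq0 negb_or => /andP[nzc _] /eqP.
by rewrite mulf_eq0 expf_eq0 (negPf nzc) andbF => /eqP.
Qed.

(** [G] cannot vanish along all of [phi], since every parameter would then be a multiple root. A
    point of the curve off [G] is thus available, and the curve is parametrized anew with this point
    at infinity. *)
Lemma transverse_points F G e m :
    (exists2 p0 : 'rV[C]_3, p0 != 0 & F.@[p0 0] = 0) ->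
    (forall p0 : 'rV[C]_3, p0 != 0 -> F.@[p0 0] = 0 -> exists phi, parametrization F p0 e phi) ->
    F \is e.-homog -> regular F -> G \is m.-homog -> transverse F G ->
  exists s : seq 'rV[C]_3, [/\ size s = (e * m)%N, uniq s,
    {in s, forall v, [/\ v != 0, F.@[v 0] = 0 & G.@[v 0] = 0]},
    {in s &, forall v w c, v = c *: w -> v = w} &
    forall v, v != 0 -> F.@[v 0] = 0 -> G.@[v 0] = 0 -> exists2 w, w \in s & exists c, v = c *: w].
Proof.
move=> [p0 nzp Fp] par hF rF hG tr; have [phi P] := par _ nzp Fp.
have [G0|] := eqVneq (mmap polyC phi G) 0; last first.
  case/closed_nonrootP => t; rewrite rootE -meval_pt => nzG.
  have nzpt := param_neq0 t P.
  have [psi Q] := par _ nzpt (param_zero P t).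
  exact: transverse_points_param Q hF rF hG nzG tr.
have Gt : G.@[(pt phi 0) 0] = 0 by rewrite meval_pt G0 horner0.
by have := param_simple_root P hF rF hG tr Gt; rewrite G0 deriv0 horner0 eqxx.
Qed.

End PlaneCurves.

(** * Jets in a chart of a blow-up *)

Section Chart.
Variable C : fieldType.
Local Notation CXt := {poly {poly C}}.
Implicit Types (a b c f g : CXt).

(* The image of C[x, y] in C[X][t] under x |-> t X, y |-> t. *)
Definition chart_pred : pred CXt :=
  fun g => [forall i : 'I_(size g), (size (g`_i)%R <= i.+1)%N].
Arguments chart_pred _ /.
Definition chart := [qualify a g | chart_pred g].

Lemma chartP g : reflect (forall i, (size (g`_i)%R <= i.+1)%N) (g \is a chart).
Proof.
apply: (iffP forallP) => [H i|H i]; last exact: H.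
have [ilt|ige] := ltnP i (size g); first exact: (H (Ordinal ilt)).
by rewrite nth_default // size_poly0.
Qed.

Lemma chart_subring : subring_closed chart.
Proof.
split.
- by apply/chartP => i; rewrite coef1; case: i => [|i] /=; rewrite ?size_poly1 ?size_poly0.
- move=> f g /chartP Hf /chartP Hg; apply/chartP => i; rewrite coefB.
  by rewrite (leq_trans (size_polyD _ _)) // size_polyN geq_max Hf Hg.
move=> f g /chartP Hf /chartP Hg; apply/chartP => i; rewrite coefM.
apply: (leq_trans (size_sum _ _ _)); apply/bigmax_leqP => j _.
apply: leq_trans (size_polyMleq _ _) _; rewrite -ltnS.
have: (size (f`_j)%R + size (g`_(i - j))%R <= i.+2)%N.
  by rewrite (leq_trans (leq_add (Hf _) (Hg _))) // addSn addnS subnKC // -ltnS.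
by case: (_ + _)%N.
Qed.
HB.instance Definition _ := GRing.isSubringClosed.Build CXt chart_pred chart_subring.

Lemma chart_monomial k (q : {poly C}) : (size q <= k.+1)%N -> q *: 'X^k \is a chart.
Proof.
move=> sq; apply/chartP => i; rewrite coefZ coefXn.
by case: eqP => [->|_]; rewrite ?mulr1 ?mulr0 ?size_poly0.
Qed.

Lemma chartC (x : C) : x%:P%:P \is a chart.
Proof.
by apply/chartP => -[|i]; rewrite coefC /= ?size_poly0 // size_polyC leq_b1.
Qed.

(** On the chart this is congruence modulo the D-th power of the maximal ideal of the origin in
    C[x, y], because the coefficient of t^i is the homogeneous part of degree i. *)
Definition jeq D a b := forall i, (i < D)%N -> a`_i = b`_i.

Lemma jeqM D a a' b b' : jeq D a a' -> jeq D b b' -> jeq D (a * b) (a' * b').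
Proof.
move=> ea eb i ltiD; rewrite !coefM; apply: eq_bigr => j _.
by rewrite ea ?eb // (leq_ltn_trans _ ltiD) // ?leq_subr // -ltnS.
Qed.

Lemma jeqD D a a' b b' : jeq D a a' -> jeq D b b' -> jeq D (a + b) (a' + b').
Proof. by move=> ea eb i ltiD; rewrite !coefD ea ?eb. Qed.

Lemma jeqxx D a : jeq D a a. Proof. by []. Qed.

Lemma jeq_sym D a b : jeq D a b -> jeq D b a.
Proof. by move=> e i ltiD; rewrite e. Qed.

Lemma jeq_trans D a b c : jeq D a b -> jeq D b c -> jeq D a c.
Proof. by move=> e e' i ltiD; rewrite e ?e'. Qed.

Lemma jeqB0 D a b : jeq D a b <-> jeq D (a - b) 0.
Proof.
split=> e i ltiD; first by rewrite coefB e // subrr coef0.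
by apply/eqP; rewrite -subr_eq0 -coefB e // coef0.
Qed.

Lemma jeq_XnM D s a b : jeq D a b -> jeq (s + D) ('X^s * a) ('X^s * b).
Proof.
move=> e i lti; rewrite !coefXnM; case: ltnP => // lesi.
by rewrite e // ltn_subLR.
Qed.

Lemma jeq_leq D D' a b : (D' <= D)%N -> jeq D a b -> jeq D' a b.
Proof. by move=> le e i lti; rewrite e // (leq_trans lti). Qed.

Lemma jeq0P D a : jeq D a 0 -> exists b, a = 'X^D * b.
Proof.
move=> e; exists (drop_poly D a); rewrite mulrC -{1}[a](poly_take_drop D).
by rewrite (_ : take_poly D a = 0) ?add0r //; apply/polyP => i; rewrite coef_take_poly coef0;
  case: ltnP => // /e; rewrite coef0.
Qed.

(** Newton iteration: replacing [g] by g (2 - f g) squares the error 1 - f g and stays in the chart.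
    The start is legitimate because the coefficient of t^0 in a chart element is a scalar. *)
Lemma chart_inverse D f : f \is a chart -> f`_0 != 0 ->
  exists2 g, g \is a chart & jeq D (f * g) 1.
Proof.
move=> cf nz; have /chartP/(_ 0%N)/size1_polyC f0 := cf.
elim: D => [|[|D] [g cg e]]; first by exists 1; rewrite ?rpred1.
  exists (f`_0`_0)^-1%:P%:P; first exact: chartC.
  move=> [|//] _; rewrite coefMC f0 coefC /= -polyCM mulfV ?coef1 //.
  by apply: contraNneq nz => z; rewrite f0 z.
exists (g * (2 - f * g)); first by rewrite rpredM ?rpredB ?rpredM ?rpred_nat.
apply/jeqB0; have -> : f * (g * (2 - f * g)) - 1 = - (f * g - 1) ^+ 2 by ring.
have /jeq0P[b ->] := (jeqB0 _ _ _).1 e.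
move=> i ltiD; rewrite coefN exprMn -exprM coefXnM ifT ?oppr0 ?coef0 //.
by rewrite (leq_trans ltiD) // muln2 -addnn addSn ltnS leq_addl.
Qed.

(* Jets of order D at the origin: coefficients of x^j y^(i-j) with j <= i < D. *)
Definition jet_index D := {i : 'I_D & 'I_i.+1}.

Definition jet_poly D (w : {ffun jet_index D -> C^o}) : CXt :=
  \sum_(ij : jet_index D) ((w ij : C) *: 'X^(tagged ij)) *: 'X^(tag ij).

Definition jet D g : {ffun jet_index D -> C^o} :=
  [ffun ij : jet_index D => g`_(tag ij)`_(tagged ij)].

Lemma jet_poly_is_linear D x (v w : {ffun jet_index D -> C^o}) :
  jet_poly (x *: v + w) = x%:P%:P * jet_poly v + jet_poly w.
Proof.
rewrite /jet_poly mulr_sumr -big_split /=; apply: eq_bigr => ij _.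
by rewrite !ffunE !scalerDl -[_ *: v ij]/(x * v ij) -!mul_polyC !polyCM !mulrA.
Qed.

Lemma jet_poly_chart D (w : {ffun jet_index D -> C^o}) : jet_poly w \is a chart.
Proof.
apply: rpred_sum => -[i j] _; apply: chart_monomial => /=.
by rewrite (leq_trans (size_scale_leq _ _)) // size_polyXn ltn_ord.
Qed.

Lemma jet_polyK D : cancel (@jet_poly D) (@jet D).
Proof.
move=> w; apply/ffunP => ij; rewrite ffunE coef_sum coef_sum (bigD1 ij) //= big1 => [|kl ne].
  by rewrite addr0 coefZ coefXn eqxx mulr1 coefZ coefXn eqxx mulr1.
rewrite coefZ coefXn; case: eqP => [e|_]; last by rewrite mulr0 coef0.
rewrite mulr1 coefZ coefXn; case: eqP => [e'|_]; last by rewrite mulr0.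
case/eqP: ne; case: ij kl e e' => [i j] [k l] /= /val_inj e; case: _ / e l => l /val_inj-> //.
Qed.

Lemma jetK D g : g \is a chart -> jeq D (jet_poly (jet D g)) g.
Proof.
move=> cg i ltiD; apply/polyP => j; have [lej|gtj] := ltnP j i.+1.
  pose ij : jet_index D := Tagged (fun i : 'I_D => 'I_i.+1) (Ordinal lej : 'I_(Ordinal ltiD).+1).
  have := congr1 (fun w : {ffun jet_index D -> C^o} => w ij) (jet_polyK (jet D g)).
  by rewrite !ffunE.
have def f : f \is a chart -> f`_i`_j = 0.
  by move=> /chartP/(_ i) sf; rewrite nth_default // (leq_trans sf).
by rewrite !def ?jet_poly_chart.
Qed.

Lemma jeq_jet D f g : jeq D f g -> jet D f = jet D g.
Proof. by move=> e; apply/ffunP => ij; rewrite !ffunE e. Qed.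

Lemma jet_is_linear D x f g : jet D (x%:P%:P * f + g) = x *: jet D f + jet D g.
Proof. by apply/ffunP => ij; rewrite !ffunE coefD coefD !coefCM. Qed.

Lemma jet_eq0 D f : f \is a chart -> jet D f = 0 -> jeq D f 0.
Proof.
move=> cf f0; apply: jeq_trans (jeq_sym (jetK cf)) _; rewrite f0.
rewrite /jet_poly big1 => [|ij _]; first exact: jeqxx.
by rewrite ffunE -mul_polyC scale0r polyC0 mul0r.
Qed.

Lemma card_jet_index D : (2 * #|{: jet_index D}| = D * D.+1)%N.
Proof.
rewrite card_tagged sumnE big_map big_enum /=.
under eq_bigr do rewrite card_ord.
elim: D => [|D IH]; first by rewrite big_ord0.
by rewrite big_ord_recr /= mulnDr IH -mulnDl mulnC addn2.
Qed.

End Chart.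

(** * Determinants and adjugates with entries in a subring *)

Section SubringMatrix.
Variables (R : comNzRingType) (S : subringClosed R).

Lemma rpred_det n (M : 'M[R]_n) : (forall i j, M i j \in S) -> \det M \in S.
Proof.
move=> H; apply: rpred_sum => s _; rewrite rpredMsign.
by apply: rpred_prod => i _; apply: H.
Qed.

Lemma rpred_adj n (M : 'M[R]_n) i j : (forall i j, M i j \in S) -> (\adj M) i j \in S.
Proof.
move=> H; rewrite mxE rpredMsign; apply: rpred_det => k l.
by rewrite !mxE; apply: H.
Qed.

End SubringMatrix.

(** * The local ideal generated by two functions with coprime leading forms *)

Section LocalIdeal.
Variables (C : fieldType) (s : nat).
Local Notation CXt := {poly {poly C}}.
(* Two functions of order s.+1 in the chart, divided by 'X^(s.+1). *)
Variables (P Q : CXt).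
Hypothesis chartP' : 'X^(s.+1) * P \is a (@chart C).
Hypothesis chartQ' : 'X^(s.+1) * Q \is a (@chart C).
Hypothesis size_q : size (Q`_0)%R = s.+2.
Hypothesis coprime_pq : coprimep P`_0 Q`_0.
Local Notation D := (s.+1 + s)%N.
Implicit Types (a b f g : CXt).

Let size_p : (size (P`_0)%R <= s.+2)%N.
Proof. by have /chartP/(_ s.+1) := chartP'; rewrite coefXnM ltnn subnn. Qed.

(** By induction on the order, the lowest parts satisfy a_i p + b_i q = 0 with p, q the leading
    forms. Coprimality makes q divide a_i, whose degree is too small unless a_i = 0. *)
Lemma syzygy_order a b : a \is a (@chart C) -> b \is a (@chart C) ->
  jeq D (a * ('X^(s.+1) * P) + b * ('X^(s.+1) * Q)) 0 -> jeq s a 0 /\ jeq s b 0.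
Proof.
move=> /chartP ca /chartP cb e.
have {}e i : (i < s)%N -> (a * P + b * Q)`_i = 0.
  move=> ltis; have := e (s.+1 + i)%N; rewrite ltn_add2l => /(_ ltis).
  by rewrite [a * _]mulrCA [b * _]mulrCA -mulrDr coefXnM ltnNge leq_addr /= addKn coef0.
suff H i : (i < s)%N -> a`_i = 0 /\ b`_i = 0.
  by split=> i /H[a0 b0]; rewrite coef0.
elim/ltn_ind: i => i IH ltis.
have : a`_i * P`_0 + b`_i * Q`_0 = 0.
  rewrite -[RHS](e i ltis) coefD !coefM !big_ord_recr /= subnn.
  by rewrite !big1 ?add0r // => j _;
    have [aj bj] := IH j (ltn_ord j) (ltn_trans (ltn_ord j) ltis); rewrite ?aj ?bj mul0r.
have nzq : Q`_0 != 0 by rewrite -size_poly_gt0 size_q.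
move=> E; have a0 : a`_i = 0.
  have : Q`_0 %| a`_i * P`_0.
    by rewrite -(dvdp_addl _ (dvdp_mull b`_i (dvdpp Q`_0))) E dvdp0.
  rewrite Gauss_dvdpl 1?coprimep_sym // => /dvdp_leq le; apply: contraTeq isT => /le.
  by rewrite size_q leqNgt (leq_ltn_trans (ca i)) // ltnS ltnW.
split=> //; move/eqP: E; rewrite a0 mul0r add0r mulf_eq0 (negPf nzq) orbF.
by move/eqP.
Qed.

(** Two coprime binary forms of degree s + 1 generate all binary forms of degree 2s + 1; here they
    are dehomogenized in X. *)
Lemma form_decomposition (f : {poly C}) : (size f <= D.+1)%N ->
  exists a b : {poly C}, [/\ (size a <= s.+1)%N, (size b <= s.+1)%N & f = a * P`_0 + b * Q`_0].
Proof.
move=> sf; have nzq : Q`_0 != 0 by rewrite -size_poly_gt0 size_q.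
have /Bezout_eq1_coprimepP[[u v] /= uv] := coprime_pq.
(* Reducing the Bezout cofactor modulo q bounds [a]; the bound on [b] then follows from b q = f - a
   p. *)
pose a := (f * u) %% Q`_0; pose b := (f * u) %/ Q`_0 * P`_0 + f * v.
have sa : (size a <= s.+1)%N by rewrite -ltnS -size_q ltn_modp.
have fE : f = a * P`_0 + b * Q`_0.
  rewrite -[LHS]mulr1 -uv mulrDr mulrA {1}(divp_eq (f * u) Q`_0) -/a /b; ring.
exists a, b; split=> //; have [->|nzb] := eqVneq b 0; first by rewrite size_poly0.
have : (size (b * Q`_0)%R <= D.+1)%N.
  have -> : b * Q`_0 = f - a * P`_0 by rewrite fE addrAC subrr add0r.
  rewrite (leq_trans (size_polyD _ _)) // geq_max size_polyN sf /=.
  rewrite (leq_trans (size_polyMleq _ _)) // -ltnS.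
  have : (size a + size (P`_0)%R <= s.+1 + s.+2)%N by rewrite leq_add.
  by rewrite !addnS; case: (_ + _)%N.
by rewrite size_mul // size_q addnS /= -[X in (_ <= X)%N]addnS leq_add2r.
Qed.

(** Everything of degree at least [D] goes to the last monomial. For [f] of degree at most i + D,
    all cofactors then have degree at most i, as the chart requires. *)
Lemma monomial_split (f : {poly C}) : f = \sum_(k < D.+1) 'X^k *
  (if k == D :> nat then drop_poly D f else (f`_k)%:P).
Proof.
rewrite big_ord_recr /= eqxx mulrC.
rewrite (eq_bigr (fun k : 'I_D => f`_k *: 'X^k)) => [|k _]; last first.
  by rewrite ltn_eqF ?ltn_ord // mulrC mul_polyC.
rewrite mulrC -{1}[f](poly_take_drop D) mulrC -poly_def.

by congr (_ + _).
Qed.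

(** A function of order at least [D] is a combination of the monomials x^k y^(D-k), which read X^k
    t^D in the chart; for order above [D] the coefficients vanish at the origin. *)
Lemma chart_split f : f \is a (@chart C) -> jeq D f 0 ->
  exists c : 'I_D.+1 -> CXt, [/\ forall k, c k \is a (@chart C),
    f = \sum_k c k * ('X^k *: 'X^D) & jeq D.+1 f 0 -> forall k, (c k)`_0 = 0].
Proof.
move=> /chartP cf f0.
pose part (k : nat) (q : {poly C}) := if k == D then drop_poly D q else (q`_k)%:P.
exists (fun k => \poly_(i < size f) part k f`_(i + D)); split.
- move=> k; apply/chartP => i; rewrite coef_poly; case: ifP => _; last by rewrite size_poly0.
  rewrite /part; case: eqP => _; last by rewrite (leq_trans (size_polyC_leq1 _)).
  by rewrite size_drop_poly leq_subLR (leq_trans (cf _)) // addnS addnC.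
- have cE k (c : CXt) n : (c * ('X^k *: 'X^D))`_n = if (n < D)%N then 0 else 'X^k * c`_(n - D).
    by rewrite -mul_polyC mulrCA mulrA coefMXn coefCM.
  apply/polyP => n; rewrite coef_sum; under eq_bigr => k _ do rewrite cE.
  have [ltnD|leDn] := ltnP n D; first by rewrite f0 // coef0 big1.
  under eq_bigr => k _ do rewrite coef_poly subnK //.
  case: (ltnP (n - D) (size f)) => [_|gt]; first exact: monomial_split.
  rewrite nth_default; last by rewrite (leq_trans gt) ?leq_subr.
  by rewrite big1 // => k _; rewrite mulr0.
move=> f1 k; rewrite coef_poly; case: ifP => // _.
rewrite f1 ?add0n // coef0 /part; case: eqP => _; last by rewrite coef0.
by apply/polyP => i; rewrite coef_drop_poly !coef0.
Qed.

(* Nakayama by Cramer: the monomials of degree D generate, modulo (P, Q), an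
   ideal equal to its product with the maximal ideal. *)
Lemma socle_vanishing f : f \is a (@chart C) -> jeq D f 0 ->
  exists d a b, [/\ d \is a (@chart C), a \is a (@chart C), b \is a (@chart C),
    d`_0 = 1 & d * f = a * ('X^(s.+1) * P) + b * ('X^(s.+1) * Q)].
Proof.
pose mon (k : 'I_D.+1) : CXt := 'X^k *: 'X^D.
have gen (k : 'I_D.+1) : exists abc : CXt * CXt * ('I_D.+1 -> CXt),
  [/\ abc.1.1 \is a (@chart C), abc.1.2 \is a (@chart C),
      forall l, abc.2 l \is a (@chart C) /\ (abc.2 l)`_0 = 0 &
      mon k + \sum_l abc.2 l * mon l = abc.1.1 * ('X^(s.+1) * P) + abc.1.2 * ('X^(s.+1) * Q)].
  have [|a [b [sa sb kE]]] := @form_decomposition 'X^k; first by rewrite size_polyXn ltn_ord.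
  (* The leading form of [mon k] has been decomposed, so the error [r] has order at least [D.+1] and
     its coefficients on the monomials vanish at the origin. *)
  pose r := (a *: 'X^s) * ('X^(s.+1) * P) + (b *: 'X^s) * ('X^(s.+1) * Q) - mon k.
  have ca : a *: 'X^s \is a (@chart C) by apply: chart_monomial.
  have cb : b *: 'X^s \is a (@chart C) by apply: chart_monomial.
  have cr : r \is a (@chart C).
    apply: rpredB; first by apply: rpredD; apply: rpredM.
    by apply: chart_monomial; rewrite size_polyXn ltn_ord.
  have rE : r = 'X^D * (a%:P * P + b%:P * Q - ('X^k)%:P).
    by rewrite /r /mon -!mul_polyC exprD; ring.
  have r0 : jeq D.+1 r 0.
    move=> i; rewrite rE coefXnM ltnS leq_eqVlt => /orP[/eqP ->|->]; last by rewrite coef0.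
    by rewrite ltnn subnn coefB coefD !coefCM coefC /= -kE subrr coef0.
  have [|c [cc rc c0]] := chart_split cr; first exact: jeq_leq r0.
  exists (a *: 'X^s, b *: 'X^s, c); split=> //= [l|].
    by split; last exact: c0.
  by rewrite -rc addrC subrK.
have [abc gE] := fin_all_exists gen.
(* [M] is the identity at the origin, so its determinant [d] has constant term 1; the adjugate
   inverts [M] up to [d] without leaving the chart. *)
pose M : 'M[CXt]_D.+1 := 1%:M + \matrix_(k, l) (abc k).2 l.
have cM k l : M k l \is a (@chart C).
  by rewrite !mxE rpredD ?rpred_nat //; have [_ _ /(_ l)[]] := gE k.
pose d := \det M; have cd : d \is a (@chart C) by apply: rpred_det.
have d0 : d`_0 = 1.
  rewrite -horner_coef0 -[_.[0]]/(horner_eval 0 d) -det_map_mx.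
  rewrite (_ : map_mx _ _ = 1%:M) ?det1 //; apply/matrixP => k l.
  rewrite [LHS]mxE -[LHS]/((M k l).[0]) horner_coef0 !mxE coefD; have [_ _ /(_ l)[_ ->] _] := gE k.
  by rewrite addr0 -polyC_natr coefC.
move=> cf /(chart_split cf)[c [cc fE _]].
pose A k l := (\adj M) k l; have cA k l : A k l \is a (@chart C) by apply: rpred_adj.
have dmon k : d * mon k =
    \sum_l A k l * ((abc l).1.1 * ('X^(s.+1) * P) + (abc l).1.2 * ('X^(s.+1) * Q)).
  pose mu : 'cV[CXt]_D.+1 := \col_k mon k.
  have /matrixP/(_ k 0) : \adj M *m (M *m mu) = d *: mu.
    by rewrite mulmxA mul_adj_mx mul_scalar_mx.
  rewrite mxE [RHS]mxE [mu _ _]mxE => <-; apply: eq_bigr => l _; congr (_ * _).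
  have [_ _ _ <-] := gE l; rewrite mulmxDl mul1mx 2!mxE; congr (_ + _).
  by rewrite mxE; apply: eq_bigr => i _; rewrite !mxE.
exists d, (\sum_k \sum_l c k * A k l * (abc l).1.1), (\sum_k \sum_l c k * A k l * (abc l).1.2).
split=> //.
- by apply: rpred_sum => k _; apply: rpred_sum => l _; rewrite !rpredM //; have [] := gE l.
- by apply: rpred_sum => k _; apply: rpred_sum => l _; rewrite !rpredM //; have [] := gE l.
rewrite {1}fE mulr_sumr !mulr_suml -big_split; apply: eq_bigr => k _ /=.
rewrite mulrCA dmon mulr_sumr !mulr_suml -big_split; apply: eq_bigr => l _ /=.
by ring.
Qed.

(** Both generators have order at least s + 1, so modulo order 2s + 1 only the jets of order [s] of
    the cofactors count. *)
Lemma jet_syzygies a b : a \is a (@chart C) -> b \is a (@chart C) ->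
  jeq D (a * ('X^(s.+1) * P) + b * ('X^(s.+1) * Q))
    (jet_poly (jet s a) * ('X^(s.+1) * P) + jet_poly (jet s b) * ('X^(s.+1) * Q)).
Proof.
move=> ca cb; have trunc c R : c \is a (@chart C) ->
    jeq D (c * ('X^(s.+1) * R)) (jet_poly (jet s c) * ('X^(s.+1) * R)).
  move=> cc; rewrite mulrCA [X in jeq _ _ X]mulrCA; apply/jeq_XnM/jeqM; last exact: jeqxx.
  by apply/jeq_sym/jetK.
by apply: jeqD; apply: trunc.
Qed.

End LocalIdeal.

Lemma rmorph_mmap n (R S S' : comNzRingType) (f : {rmorphism R -> S}) (g : {rmorphism S -> S'})
    (h : 'I_n -> S) (G : {mpoly R[n]}) :
  g (mmap f h G) = mmap (g \o f) (g \o h) G.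
Proof.
rewrite /mmap rmorph_sum; apply: eq_bigr => m _; rewrite rmorphM /mmap1 rmorph_prod.
by congr (_ * _); apply: eq_bigr => i _; rewrite rmorphXn.
Qed.

Lemma eq_mmap n (R S : comNzRingType) (f f' : R -> S) (h h' : 'I_n -> S) (G : {mpoly R[n]}) :
  f =1 f' -> h =1 h' -> mmap f h G = mmap f' h' G.
Proof.
move=> ef eh; apply: eq_bigr => m _; rewrite ef; congr (_ * _).
by apply: eq_bigr => i _; rewrite eh.
Qed.

Lemma mmap_mpolyX n (R : comNzRingType) (G : {mpoly R[n]}) :
  mmap (@mpolyC n R) (fun i => 'X_i) G = G.
Proof. by rewrite [RHS]mpolyE; apply: eq_bigr => m _; rewrite mul_mpolyC mmap1_id. Qed.

Lemma sum_ord3 (V : nmodType) (f : 'I_3 -> V) : \sum_i f i = f 0 + f 1 + f ord_max.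
Proof.
rewrite !big_ord_recl big_ord0 addr0 addrA; congr (_ + f _ + f _); exact: val_inj.
Qed.

(** * Homogeneous forms in the chart *)

Section BlowUp.
Variables (C : fieldType) (B : 'M[C]_3).
Hypothesis unitB : B \in unitmx.
Local Notation form := {mpoly C[3]}.
Local Notation CXt := {poly {poly C}}.
Implicit Types (F G : form).

Definition blowup_coord (i : 'I_3) : CXt :=
  (B 0 i)%:P%:P + 'X * ((B 1 i)%:P%:P + 'X%:P * (B ord_max i)%:P%:P).

(* In coordinates with respect to the rows of B, this is the substitution
   (z, y, x) = (1, t, t X), i.e. a chart of the blow-up of the point z. *)
Definition blowup : form -> CXt := mmap (polyC \o polyC) blowup_coord.
HB.instance Definition _ := GRing.RMorphism.on blowup.

Definition dir (k : 'I_3) F : form := \sum_i B k i *: F^`M(i).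

(** The linear forms dual to the rows of [B]: z, y, x for k = 0, 1, 2. *)
Definition coord (k : 'I_3) : form := \sum_i invmx B i k *: 'X_i.

Lemma blowupZ c F : blowup (c *: F) = c%:P%:P * blowup F.
Proof. exact: mmapZ. Qed.

Lemma blowupX i : blowup 'X_i = blowup_coord i.
Proof. by rewrite /blowup mmapX mmap1U. Qed.

Lemma chart_blowup G : blowup G \is a (@chart C).
Proof.
have cX : 'X \is a (@chart C).
  have := @chart_monomial C 1 1; rewrite scale1r expr1 => -> //.
  by rewrite size_poly1.
have ctX : 'X * 'X%:P \is a (@chart C).
  have := @chart_monomial C 1 'X; rewrite -mul_polyC expr1 mulrC => -> //.
  by rewrite size_polyX.
have ch i : blowup_coord i \is a (@chart C).
  rewrite /blowup_coord mulrDr mulrA; apply: rpredD; first exact: chartC.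
  by apply: rpredD; apply: rpredM => //; apply: chartC.
apply: rpred_sum => m _; apply: rpredM; first exact: chartC.
by apply: rpred_prod => i _; apply/rpredX/ch.
Qed.

(** The whole exceptional line t = 0 lies over the point [row 0 B]. *)
Lemma blowup_coef0 G : (blowup G)`_0 = (G.@[row 0 B 0])%:P.
Proof.
rewrite -horner_coef0 -[_.[0]]/(horner_eval 0 (blowup G)) rmorph_mmap.
rewrite /meval -[RHS]/(polyC (mmap idfun _ G)) rmorph_mmap.
apply: eq_mmap => [c|i] /=; rewrite /horner_eval ?hornerC //.
by rewrite /blowup_coord hornerD hornerM hornerX mul0r addr0 hornerC mxE.
Qed.

Lemma coord_homog k : coord k \is 1.-homog.
Proof. by apply: rpred_sum => i _; apply: rpredZ; rewrite dhomogX /= mdeg1. Qed.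

Lemma dir_homog e k F : F \is e.-homog -> dir k F \is e.-1.-homog.
Proof. by move=> hF; apply: rpred_sum => i _; apply/rpredZ/dhomog_mderiv. Qed.

Let sum_inv i j : \sum_k invmx B j k * B k i = (j == i)%:R.
Proof. by have := mulVmx unitB => /matrixP/(_ j i); rewrite !mxE. Qed.

Lemma sum_coord i : \sum_k B k i *: coord k = 'X_i.
Proof.
under eq_bigr do rewrite scaler_sumr.
rewrite exchange_big /= -[RHS]scale1r.
have E j : \sum_k B k i *: (invmx B j k *: 'X_j) = (j == i)%:R *: 'X_j :> form.
  by rewrite -sum_inv scaler_suml; apply: eq_bigr => k _; rewrite scalerA mulrC.
under eq_bigr do rewrite E.
by rewrite (bigD1 i) //= eqxx big1 ?addr0 // => j /negPf ->; rewrite scale0r.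
Qed.

Lemma mderiv_dir F i : F^`M(i) = \sum_k invmx B i k *: dir k F.
Proof.
under eq_bigr do rewrite scaler_sumr.
rewrite exchange_big /= -[LHS]scale1r.
have E j : \sum_k invmx B i k *: (B k j *: F^`M(j)) = (i == j)%:R *: F^`M(j).
  by rewrite -sum_inv scaler_suml; apply: eq_bigr => k _; rewrite scalerA.
under eq_bigr do rewrite E.
by rewrite (bigD1 i) //= eqxx big1 ?addr0 // => j; rewrite eq_sym => /negPf ->; rewrite scale0r.
Qed.

Lemma blowup_coordE k : blowup (coord k) =
  (k == 0)%:R + 'X * ((k == 1)%:R + 'X%:P * (k == ord_max)%:R).
Proof.
have BN j : \sum_i (invmx B i k)%:P%:P * (B j i)%:P%:P = (k == j)%:R :> CXt.
  have := mulmxV unitB => /matrixP/(_ j k); rewrite !mxE eq_sym.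
  move=> /(congr1 (polyC \o polyC)) /=; rewrite !polyC_natr => <-.
  rewrite !rmorph_sum; apply: eq_bigr => i _.
  by rewrite mulrC !rmorphM.
have E i : blowup (invmx B i k *: 'X_i) = (invmx B i k)%:P%:P * (B 0 i)%:P%:P +
    ('X * ((invmx B i k)%:P%:P * (B 1 i)%:P%:P) +
     'X * 'X%:P * ((invmx B i k)%:P%:P * (B ord_max i)%:P%:P)).
  by rewrite blowupZ blowupX /blowup_coord; ring.
rewrite rmorph_sum (eq_bigr _ (fun i _ => E i)) big_split /= big_split /=.
by rewrite -!mulr_sumr !BN; ring.
Qed.

Lemma blowup_euler e F : F \is e.-homog ->
  blowup (dir 0 F) + 'X * (blowup (dir 1 F) + 'X%:P * blowup (dir ord_max F)) = blowup F *+ e.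
Proof.
move=> hF; rewrite -rmorphMn -(euler_homog hF) rmorph_sum.
rewrite /dir !rmorph_sum mulr_sumr -big_split mulr_sumr -big_split /=.
by apply: eq_bigr => i _; rewrite rmorphM /= blowupX !blowupZ /blowup_coord; ring.
Qed.

Lemma deriv_blowup F : (blowup F)^`() = blowup (dir 1 F) + 'X%:P * blowup (dir ord_max F).
Proof.
rewrite /blowup mmap_derivation => [|x y|c] /=; rewrite ?derivM ?derivC //.
rewrite -!/blowup /dir !rmorph_sum mulr_sumr -big_split; apply: eq_bigr => i _ /=.
rewrite !blowupZ /blowup_coord derivD derivC add0r derivM derivX mul1r derivD derivM.
by rewrite !derivC; ring.
Qed.

Lemma map_derivM (a b : CXt) :
  map_poly (@deriv C) (a * b) = map_poly (@deriv C) a * b + a * map_poly (@deriv C) b.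
Proof.
apply/polyP => i; rewrite coefD !coefM coef_map_id0 ?deriv0 // coefM raddf_sum -big_split /=.
by apply: eq_bigr => j _; rewrite derivM !coef_map_id0 ?deriv0.
Qed.

(** The inner variable X enters only through x = t X, hence the factor t. *)
Lemma map_deriv_blowup F : map_poly (@deriv C) (blowup F) = 'X * blowup (dir ord_max F).
Proof.
rewrite /blowup mmap_derivation => [|x y|c] /=; last 2 first.
- exact: map_derivM.
- by rewrite map_polyC /= derivC.
rewrite -!/blowup /dir !rmorph_sum mulr_sumr; apply: eq_bigr => i _ /=.
have dC (c : C) : map_poly (@deriv C) c%:P%:P = 0 by rewrite map_polyC /= derivC.
have dX : map_poly (@deriv C) 'X = 0.
  by apply/polyP => -[|[|j]]; rewrite coef_map_id0 ?deriv0 // coefX coef0 ?deriv0 // derivC.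
rewrite !blowupZ /blowup_coord raddfD /= dC add0r map_derivM dX mul0r add0r raddfD /= dC add0r.
by rewrite map_derivM dC mulr0 addr0 map_polyC /= derivX; ring.
Qed.

(** Homogenization: X^j t^i comes from x^j y^(i-j) z^(n-i). The chart condition gives j <= i and the
    bound on the size gives i <= n. *)
Lemma blowup_lift n a : a \is a (@chart C) -> (size a <= n.+1)%N ->
  exists2 A, A \is n.-homog & blowup A = a.
Proof.
move=> ca sa; have czE : blowup (coord 0) = 1 by rewrite blowup_coordE /= mulr0 addr0 mulr0 addr0.
have cyE : blowup (coord 1) = 'X by rewrite blowup_coordE /= mulr0 addr0 mulr1 add0r.
have cxE : blowup (coord ord_max) = 'X * 'X%:P by rewrite blowup_coordE /= mulr1 add0r add0r.
pose mon i j : form := coord ord_max ^+ j * coord 1 ^+ (i - j) * coord 0 ^+ (n - i).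
have mon_homog i j : (j <= i)%N -> (i <= n)%N -> mon i j \is n.-homog.
  move=> ji le_in; have H k m : coord k ^+ m \is m.-homog.
    by rewrite -[m in m.-homog]mul1n; apply/dhomogMn/coord_homog.
  by have := dhomogM (dhomogM (H ord_max j) (H 1 (i - j)%N)) (H 0 (n - i)%N); rewrite !subnKC.
have mon_blowup i j : (j <= i)%N -> blowup (mon i j) = 'X^j *: 'X^i.
  move=> ji; rewrite /mon !rmorphM !rmorphXn /= czE cyE cxE expr1n mulr1 exprMn mulrAC -exprD.
  by rewrite subnKC // mulrC -rmorphXn mul_polyC.
exists (\sum_(i < n.+1) \sum_(j < i.+1) a`_i`_j *: mon i j).
  by apply: rpred_sum => i _; apply: rpred_sum => j _; apply/rpredZ/mon_homog; rewrite -ltnS.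
have trunc (R : nzRingType) (q : {poly R}) m : (size q <= m)%N -> q = \sum_(i < m) q`_i *: 'X^i.
  move=> sq; rewrite -poly_def; apply/polyP => k; rewrite coef_poly.
  by case: ltnP => // ge; rewrite nth_default // (leq_trans sq).
rewrite [RHS](trunc _ a n.+1 sa) rmorph_sum; apply: eq_bigr => i _ /=.
rewrite rmorph_sum [X in _ = X *: _](trunc _ _ i.+1) ?scaler_suml; last exact: (chartP _ ca).
apply: eq_bigr => j _; rewrite /= blowupZ.
rewrite mon_blowup; last by rewrite -ltnS.
by rewrite -!mul_polyC polyCM mulrA.
Qed.

(* Evaluation at X = x / y and t = y / z is a left inverse up to a power of z. *)
Lemma blowup_inj n F : F \is n.-homog -> blowup F = 0 -> F = 0.
Proof.
move=> hF F0.
have nz0 : coord 0 != 0.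
  apply: contra_neq (oner_neq0 CXt) => c0.
  by have := blowup_coordE 0; rewrite c0 rmorph0 /= mulr0 addr0 mulr0 addr0.
have nz1 : coord 1 != 0.
  apply: contra_neq (negbT (polyX_eq0 {poly C})) => c0.
  by have := blowup_coordE 1; rewrite c0 rmorph0 /= mulr0 addr0 mulr1 add0r.
pose z : {fraction form} := tofrac (coord 0).
have nzz : z != 0 by rewrite tofrac_eq0.
have nzy : tofrac (coord 1) != 0 :> {fraction form} by rewrite tofrac_eq0.
pose iota : {rmorphism C -> {fraction form}} := @tofrac {mpoly C[3]} \o @mpolyC 3 C.
pose ev1 : {rmorphism {poly C} -> {fraction form}} :=
  horner_eval (tofrac (coord ord_max) / tofrac (coord 1)) \o map_poly iota.
pose ev : {rmorphism CXt -> {fraction form}} := horner_eval (tofrac (coord 1) / z) \o map_poly ev1.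
pose tau := tofrac (coord 1) / z; pose sig := tofrac (coord ord_max) / tofrac (coord 1).
have evE g : ev g = (map_poly ev1 g).[tau] by [].
have ev1E q : ev1 q = (map_poly iota q).[sig] by [].
have evC c : ev c%:P%:P = iota c.
  transitivity (ev1 c%:P); last by rewrite ev1E map_polyC hornerC.
  by rewrite evE map_polyC hornerC.
have evX : ev 'X = tau by rewrite evE map_polyX hornerX.
have evY : ev 'X%:P = sig.
  transitivity (ev1 'X); last by rewrite ev1E map_polyX hornerX.
  by rewrite evE map_polyC hornerC.
have affine (L : fieldType) (a b c x' y' z' : L) : z' != 0 -> y' != 0 ->
    a + y' / z' * (b + x' / y' * c) = z'^-1 * (a * z' + b * y' + c * x').
  by move=> nz' ny'; field; rewrite nz' ny'.
have evh i : ev (blowup_coord i) = z^-1 * tofrac 'X_i.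
  have iotaE c : tofrac c%:MP = iota c by [].
  rewrite -sum_coord sum_ord3 !tofracD -!mul_mpolyC !tofracM !iotaE -/z.
  rewrite /blowup_coord (rmorphD ev) (rmorphM ev) (rmorphD ev) (rmorphM ev) !evC evX evY.
  exact: affine nzz nzy.
apply/eqP; rewrite -tofrac_eq0.
have : ev (blowup F) = z^-1 ^+ n * tofrac F.
  rewrite rmorph_mmap -[in RHS](mmap_mpolyX F) rmorph_mmap -mmap_homogZ //.
  by apply: eq_mmap => [c|i] /=; [exact: evC | exact: evh].
rewrite F0 rmorph0 => /esym/eqP; rewrite mulf_eq0 expf_eq0 invr_eq0.
by rewrite (negPf nzz) andbF.
Qed.

End BlowUp.

(** * The Jacobian ideal at an ordinary point *)

Section TangentIdeal.
Variables (C : fieldType) (D : nat) (P Q : {poly {poly C}}).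
Local Notation chart := (@chart C).
Implicit Types h c : {poly {poly C}}.

Definition generated_upto h := exists a b,
  [/\ a \is a chart, b \is a chart & jeq D h (a * P + b * Q)].

Lemma generated_upto0 : generated_upto 0.
Proof.
exists 0, 0; split; [exact: rpred0 | exact: rpred0 |].
by rewrite !mul0r addr0; exact: jeqxx.
Qed.

Lemma generated_uptol : generated_upto P.
Proof.
exists 1, 0; split; [exact: rpred1 | exact: rpred0 |].
by rewrite mul1r mul0r addr0; exact: jeqxx.
Qed.

Lemma generated_uptor : generated_upto Q.
Proof.
exists 0, 1; split; [exact: rpred0 | exact: rpred1 |].
by rewrite mul1r mul0r add0r; exact: jeqxx.
Qed.

Lemma generated_uptoD h h' : generated_upto h -> generated_upto h' -> generated_upto (h + h').
Proof.
move=> [a [b [ca cb E]]] [a' [b' [ca' cb' E']]]; exists (a + a'), (b + b').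
by split; try exact: rpredD; rewrite !mulrDl addrACA; apply: jeqD.
Qed.

Lemma generated_uptoM c h : c \is a chart -> generated_upto h -> generated_upto (c * h).
Proof.
move=> cc [a [b [ca cb E]]]; exists (c * a), (c * b).
split; try exact: rpredM; rewrite -!mulrA -mulrDr; apply: jeqM; [exact: jeqxx | exact: E].
Qed.

End TangentIdeal.

Section OrdinaryPoint.
Variable C : numFieldType.
Local Notation form := {mpoly C[3]}.
Variables (F : form) (e : nat) (B : 'M[C]_3) (s : nat) (g : {poly {poly C}}).
Hypothesis unitB : B \in unitmx.
Hypothesis homF : F \is e.-homog.
Hypothesis FE : blowup B F = 'X^(s.+2) * g.
Hypothesis size_g0 : size (g`_0)%R = s.+3.
Hypothesis sep_g0 : coprimep g`_0 (g`_0)^`().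
Hypothesis le_s2 : (s <= 2)%N.
Local Notation psi := (blowup B).
Local Notation D := (s.+1 + s)%N.
Local Notation chart := (@chart C).

(** [Q] and [P] are the x- and y-derivatives of t^(s+2) g divided by t^(s+1); the y-derivative is
    d/dt minus X times the x-derivative. *)
Let Q := map_poly (@deriv C) g.
Let P := g *+ s.+2 + 'X * g^`() - 'X%:P * Q.

Let leD : (D <= s.+3)%N.
Proof. by move: le_s2; clear; lia. Qed.

Let nz2 : (s.+2)%:R != 0 :> C.
Proof. by rewrite pnatr_eq0. Qed.

Let psiQ : psi (dir B ord_max F) = 'X^(s.+1) * Q.
Proof.
apply: (mulfI (negbT (polyX_eq0 {poly C}))); rewrite -map_deriv_blowup FE map_derivM /Q.
rewrite (_ : map_poly _ 'X^_ = 0) ?mul0r ?add0r; first by rewrite exprS mulrA.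
apply/polyP => i; rewrite coef_map_id0 ?deriv0 // coefXn coef0.
by case: (i == _); rewrite ?deriv0 // derivC.
Qed.

Let psiP : psi (dir B 1 F) = 'X^(s.+1) * P.
Proof.
have := deriv_blowup B F; rewrite psiQ => /(canLR (addrK _)) <-.
rewrite FE derivM derivXn /P /= (exprS _ s.+1) mulrBr mulrDr mulrnAl mulrnAr -mulrA.
by rewrite ['X * (_ * _)]mulrCA ['X%:P * (_ * _)]mulrCA.
Qed.

Let Q0 : Q`_0 = (g`_0)^`().
Proof. by rewrite coef_map_id0 ?deriv0. Qed.

Let P0 : P`_0 = g`_0 *+ s.+2 - 'X * (g`_0)^`().
Proof. by rewrite coefB coefD coefMn coefXM addr0 coefCM Q0. Qed.

(** In characteristic zero differentiation lowers the degree by exactly one. *)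
Let size_Q0 : size (Q`_0)%R = s.+2.
Proof.
rewrite Q0; apply/eqP; rewrite eqn_leq; apply/andP; split.
  by rewrite -ltnS -size_g0 lt_size_deriv // -size_poly_gt0 size_g0.
rewrite ltnNge; apply/negP => /leq_sizeP/(_ _ (leqnn _)); rewrite coef_deriv => /eqP.
rewrite mulrn_eq0 /=; have := size_g0; rewrite /lead_coef => sz /eqP g0.
have : lead_coef g`_0 = 0 by rewrite /lead_coef sz.
by move/eqP; rewrite lead_coef_eq0 -size_poly_eq0 sz.
Qed.

(** Modulo the derivative of the leading form, which is the leading form of [Q], that of [P] is s +
    2 times the leading form itself; coprimality is thus separability. *)
Let coprime_PQ : coprimep P`_0 Q`_0.
Proof.
rewrite P0 Q0 coprimep_sym addrC -mulNr coprimep_addl_mul -scaler_nat coprimepZr //.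
by rewrite coprimep_sym.
Qed.

Let chartP' : 'X^(s.+1) * P \is a chart.
Proof. by rewrite -psiP chart_blowup. Qed.

Let chartQ' : 'X^(s.+1) * Q \is a chart.
Proof. by rewrite -psiQ chart_blowup. Qed.

Let chartY : 'X * 'X%:P \is a chart.
Proof.
have := @chart_monomial C 1 'X; rewrite -mul_polyC expr1 mulrC => -> //.
by rewrite size_polyX.
Qed.

Let chartX : 'X \is a chart.
Proof.
have := @chart_monomial C 1 1; rewrite scale1r expr1 => -> //.
by rewrite size_poly1.
Qed.

Let Pt := psi (dir B 1 F).
Let Qt := psi (dir B ord_max F).

(* By Euler's formula F is, up to order s.+3, a combination of its derivatives
   transverse to p; the bound s <= 2 says that s.+3 is at least D. *)
Let generated_dir0 : generated_upto D Pt Qt (psi (dir B 0 F)).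
Proof.
rewrite /Pt /Qt psiP psiQ.
pose c : {poly {poly C}} := ((s.+2)%:R^-1)%:P%:P.
have cs : c *+ s.+2 = 1.
  by rewrite -[c *+ _]mulr_natr /c -!polyC_natr -!polyCM mulVf.
have cc : c *+ e - 1 \is a chart by rewrite rpredB ?rpred1 // rpredMn // chartC.
exists ((c *+ e - 1) * 'X), ((c *+ e - 1) * ('X * 'X%:P)); split; try exact: rpredM.
(* The affine Euler relation: y d_y + x d_x multiplies the leading part by s + 2, up to higher
   order. Comparing it with the projective relation of weight [e] eliminates [F]. *)
have EF : 'X * ('X^(s.+1) * P) + 'X * 'X%:P * ('X^(s.+1) * Q) =
    psi F *+ s.+2 + 'X^(s.+3) * g^`().
  have alg (A : comNzRingType) (a b x u v w : A) :
      a * (x * (u + a * v - b * w)) + a * b * (x * w) = a * x * u + a * (a * x) * v.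
    by ring.
  by rewrite FE -mulrnAr (exprS _ s.+2) (exprS _ s.+1) alg.
have -> : psi (dir B 0 F) = (c *+ e - 1) * 'X * ('X^(s.+1) * P) +
    (c *+ e - 1) * ('X * 'X%:P) * ('X^(s.+1) * Q) - 'X^(s.+3) * (c *+ e * g^`()).
  have := blowup_euler B homF; rewrite psiP psiQ => /(canRL (addrK _)) ->.
  rewrite -(mulr1 (psi F *+ e)) -cs.
  have -> : psi F *+ e * (c *+ s.+2) = c *+ e * (psi F *+ s.+2).
    by rewrite !mulrnAl !mulrnAr [c * _]mulrC mulrnAC.
  have -> : psi F *+ s.+2 = 'X * ('X^(s.+1) * P) + 'X * 'X%:P * ('X^(s.+1) * Q) - 'X^(s.+3) * g^`().
    by rewrite EF addrK.
  have alg (A : comNzRingType) (k a b x z t u v : A) :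
      k * (a * (x * t) + a * b * (x * u) - z * v) - a * (x * t + b * (x * u)) =
      (k - 1) * a * (x * t) + (k - 1) * (a * b) * (x * u) - z * (k * v).
    by ring.
  by rewrite cs; apply: alg.
apply: (jeqB0 _ _ _).2; rewrite addrAC subrr add0r => i ltiD; rewrite coefN coefXnM coef0.
by rewrite (leq_trans ltiD leD) oppr0.
Qed.

Lemma jacobian_generated (c : 'I_3 -> form) : generated_upto D Pt Qt (psi (\sum_i c i * F^`M(i))).
Proof.
have dirP k : generated_upto D Pt Qt (psi (dir B k F)).
  have [->|k1] := eqVneq k 1; first exact: generated_uptol.
  have [->|k2] := eqVneq k ord_max; first exact: generated_uptor.
  suff -> : k = 0 by exact: generated_dir0.
  by apply/val_inj; move: k k1 k2 => [[|[|[|//]]] ?].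
rewrite rmorph_sum; elim/big_ind: _ => [|x y|i _].
- exact: generated_upto0.
- exact: generated_uptoD.
rewrite rmorphM; apply: generated_uptoM; first exact: chart_blowup.
rewrite (mderiv_dir unitB) rmorph_sum; elim/big_ind: _ => [|x y|k _].
- exact: generated_upto0.
- exact: generated_uptoD.
by rewrite /= blowupZ; apply: generated_uptoM; [exact: chartC | exact: dirP].
Qed.

Lemma ordinary_syzygy_order a b : a \is a chart -> b \is a chart ->
  jeq D (a * Pt + b * Qt) 0 -> jeq s a 0 /\ jeq s b 0.
Proof. by rewrite /Pt /Qt psiP psiQ; apply: syzygy_order. Qed.

Lemma ordinary_socle_vanishing f : f \is a chart -> jeq D f 0 ->
  exists d a b, [/\ d \is a chart, a \is a chart, b \is a chart,
    d`_0 = 1 & d * f = a * Pt + b * Qt].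
Proof. by rewrite /Pt /Qt psiP psiQ; apply: socle_vanishing. Qed.

Lemma ordinary_jet_syzygies a b : a \is a chart -> b \is a chart ->
  jeq D (a * Pt + b * Qt) (jet_poly (jet s a) * Pt + jet_poly (jet s b) * Qt).
Proof. by rewrite /Pt /Qt psiP psiQ; apply: jet_syzygies. Qed.

End OrdinaryPoint.

(** * The Tjurina number of an ordinary point *)

Local Open Scope classical_set_scope.
Local Open Scope ring_scope.

Lemma linear_bij_dim (F : fieldType) (U V : vectType F) (f : U -> V) :
    linear f -> (forall u, f u = 0 -> u = 0) -> (forall v, exists u, f u = v) ->
  dim U = dim V.
Proof.
move=> lf injf surjf; pose g : {linear U -> V} := HB.pack f (GRing.isLinear.Build _ _ _ _ f lf).
have kg : (fullv :&: lker (linfun g))%VS = 0%VS.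
  apply/eqP; rewrite -subv0; apply/subvP => u; rewrite memv_cap memv_ker lfunE => /andP[_ /eqP].
  by move=> /injf ->; rewrite mem0v.
rewrite -!dimvf -(limg_dim_eq kg); congr (\dim _); apply/vspaceP => v.
rewrite memvf; have [u <-] := surjf v; apply/memv_imgP.
by exists u; rewrite ?memvf // lfunE.
Qed.

Section Tjurina.
Variable R : realType.
Local Notation C := R[i].
Local Notation form := {mpoly C[3]}.
Local Notation K := {fraction {mpoly C[3]}}.

Definition cst (c : C) : K := tofrac c%:MP.

(** [T] is a linear correspondence from [V] onto [E] under which [W] is the preimage of the image of
    [L]. Hence a basis of V / W together with [L] yields an isomorphism from C^n x E1 to [E]. [T]
    will be Taylor expansion, a relation because germs are given as fractions. *)
Lemma quotient_dim_codim (V W : set K) n (E E1 : vectType C) (L : E1 -> E)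
    (T : K -> E -> Prop) :
    linear L -> (forall a, L a = 0 -> a = 0) -> V 0 ->
    (forall x, V x -> exists w, T x w) ->
    (forall w, exists2 x, V x & T x w) ->
    (forall c x y w w', T x w -> T y w' -> T (cst c * x + y) (c *: w + w')) ->
    (forall x w, T x w -> W x <-> exists a, w = L a) ->
  quotient_dim V W n -> (n + dim E1)%N = dim E.
Proof.
move=> linL injL V0 Tex Tsurj Tlin TW [b [Vb bP]].
have L0 : L 0 = 0 by have := linL (-1) 0 0; rewrite scaler0 addr0 scaleN1r addNr.
have T00 : T 0 0.
  have [w Tw] := Tex 0 V0; have := Tlin (-1) _ _ _ _ Tw Tw.
  by rewrite mulr0 add0r scaleN1r addNr.
have W0 : W 0 by apply/(TW _ _ T00); exists 0.
have [w Tw] := fin_all_exists (fun i => Tex _ (Vb i)).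
have Tsum (c : 'rV[C]_n) : T (\sum_i cst (c 0 i) * b i) (\sum_i c 0 i *: w i).
  by elim/big_ind2: _ => // [x u y v Tx Ty|i _];
    [have := Tlin 1 _ _ _ _ Tx Ty; rewrite /cst mpolyC1 tofrac1 mul1r scale1r
    |have := Tlin (c 0 i) _ _ _ _ (Tw i) T00; rewrite !addr0].
pose f (ca : 'rV[C]_n * E1) : E := \sum_i ca.1 0 i *: w i + L ca.2.
have linf : linear f.
  move=> x [c a] [c' a']; rewrite /f /= linL scalerDr addrACA; congr (_ + _).
  rewrite scaler_sumr -big_split; apply: eq_bigr => i _ /=.
  by rewrite !mxE scalerDl scalerA.
have cstN c : cst (- c) = - cst c by rewrite /cst mpolyCN tofracN.
rewrite (_ : (n + dim E1)%N = dim ('rV[C]_n * E1)%type); last by rewrite -{1}[n]mul1n.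
apply: (linear_bij_dim linf) => [[c a]|v].
  rewrite /f /= => E0.
  have Wc : W (\sum_i cst (c 0 i) * b i).
    apply/(TW _ _ (Tsum c)); exists (- a).
    have := linL (-1) a 0; rewrite L0 !addr0 !scaleN1r => ->.
    by apply/eqP; rewrite -addr_eq0 E0.
  (* Both 0 and -c are coordinates of the zero germ modulo [W], so uniqueness gives c = 0. *)
  have [c0 [_ uniq]] := bP 0 V0.
  have c00 : c0 = 0.
    apply: uniq; rewrite big1 ?subr0 // => i _.
    by rewrite mxE -[tofrac _]/(cst 0) /cst mpolyC0 tofrac0 mul0r.
  have cN : c0 = - c.
    apply: uniq; rewrite sub0r -sumrN; move: Wc; congr W; apply: eq_bigr => i _.
    by rewrite mxE -[tofrac _]/(cst (- c 0 i)) cstN mulNr opprK.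
  have {}c00 : c = 0 by rewrite -[c]opprK -cN c00 oppr0.
  congr pair => //; apply: injL; move: E0; rewrite c00 big1 ?add0r // => i _.
  by rewrite mxE scale0r.
have [x Vx Tx] := Tsurj v; have [c [Wc _]] := bP x Vx.
have : T (x - \sum_i cst (c 0 i) * b i) (v - \sum_i c 0 i *: w i).
  have := Tlin (-1) _ _ _ _ (Tsum c) Tx.
  by rewrite cstN /cst mpolyC1 tofrac1 mulN1r scaleN1r ![- _ + _]addrC.
move/TW => [/(_ Wc)[a va] _].
by exists (c, a); rewrite /f /= -va addrC subrK.
Qed.

(* psi stands for the substitution [blowup B] and Pt, Qt for two transverse
   derivatives in the chart.  They are abstract here because unification would
   otherwise unfold them. *)
Section LocalTjurina.
Variables (F Fu Fv : form) (e : nat) (p : P2 R) (s : nat).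
Variables (psi : {rmorphism form -> {poly {poly C}}}) (Pt Qt : {poly {poly C}}).
Local Notation D := (s.+1 + s)%N.
Local Notation chart := (@chart C).
Hypothesis psi_chart : forall G, psi G \is a chart.
Hypothesis psiZ : forall c G, psi (c *: G) = c%:P%:P * psi G.
Hypothesis psi_coef0 : forall G, (psi G)`_0 = (G.@[coords p])%:P.
Hypothesis psi_lift : forall n a, a \is a chart -> (size a <= n.+1)%N ->
  exists2 A, A \is n.-homog & psi A = a.
Hypothesis psi_inj : forall n G, G \is n.-homog -> psi G = 0 -> G = 0.
Hypothesis homFu : Fu \is e.-homog.
Hypothesis homFv : Fv \is e.-homog.
Hypothesis psiFu : psi Fu = Pt.
Hypothesis psiFv : psi Fv = Qt.
Hypothesis jacobianFuv : forall A A', jacobian_ideal F (A * Fu + A' * Fv).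
Hypothesis jacobian_gen : forall G, jacobian_ideal F G -> generated_upto D Pt Qt (psi G).
Hypothesis syz_order : forall a b, a \is a chart -> b \is a chart ->
  jeq D (a * Pt + b * Qt) 0 -> jeq s a 0 /\ jeq s b 0.
Hypothesis socle : forall f, f \is a chart -> jeq D f 0 ->
  exists d a b, [/\ d \is a chart, a \is a chart, b \is a chart,
    d`_0 = 1 & d * f = a * Pt + b * Qt].
Hypothesis jet_syz : forall a b, a \is a chart -> b \is a chart ->
  jeq D (a * Pt + b * Qt) (jet_poly (jet s a) * Pt + jet_poly (jet s b) * Qt).

Let Pt_chart : Pt \is a chart. Proof. by rewrite -psiFu. Qed.
Let Qt_chart : Qt \is a chart. Proof. by rewrite -psiFv. Qed.

Let jets m := {ffun jet_index m -> C^o}.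

(** Its image will be the space of jets of the stalk of the Jacobian ideal. *)
Let syz (ab : jets s * jets s) : jets D :=
  jet D (jet_poly ab.1 * Pt + jet_poly ab.2 * Qt).

Let syz_linear : linear syz.
Proof.
move=> x [a b] [a' b']; rewrite /syz /= !jet_poly_is_linear -jet_is_linear; congr (jet D _).
have alg (A : comNzRingType) (k a1 a2 b1 b2 t u : A) :
    (k * a1 + a2) * t + (k * b1 + b2) * u = k * (a1 * t + b1 * u) + (a2 * t + b2 * u).
  by ring.
exact: alg.
Qed.

Let syz_inj ab : syz ab = 0 -> ab = 0.
Proof.
case: ab => a b /(jet_eq0 _) E.
have {E}/syz_order : jeq D
    (jet_poly a * Pt + jet_poly b * Qt) 0.
  by apply: E; rewrite rpredD // rpredM ?jet_poly_chart.
have jet0 m : jet m (0 : {poly {poly C}}) = 0.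
  by apply/ffunP => ij; rewrite !ffunE !coef0.
case=> //; try exact: jet_poly_chart.
move=> /jeq_jet; rewrite jet_polyK jet0 => -> /jeq_jet.
by rewrite jet_polyK jet0 => ->.
Qed.

Let psi_coef0_neq0 H : ~~ on_curve H p -> (psi H)`_0 != 0.
Proof. by rewrite psi_coef0 polyC_eq0. Qed.

Let neq0_of_off_curve (H : form) : ~~ on_curve H p -> H != 0.
Proof. by apply: contraNneq => ->; rewrite /on_curve meval0. Qed.

(* w is the jet of the germ x = G / H; no inverse of H is needed to say so. *)
Let taylor (x : K) (w : jets D) := exists G H m, [/\ G \is m.-homog, H \is m.-homog,
  ~~ on_curve H p, x = tofrac G / tofrac H & jeq D (psi G) (psi H * jet_poly w)].

Let taylor_ex x : stalk setT p x -> exists w, taylor x w.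
Proof.
move=> [G [H [m [_ hG hH nH xE]]]].
have [h ch hE] := chart_inverse D (psi_chart H) (psi_coef0_neq0 nH).
exists (jet D (h * psi G)), G, H, m; split=> //; apply: jeq_sym.
have e1 : jeq D (psi H * jet_poly (jet D (h * psi G))) (psi H * (h * psi G)).
  by apply: jeqM; [exact: jeqxx | apply/jetK/rpredM => //; exact: psi_chart].
apply: jeq_trans e1 _; rewrite mulrA -[X in jeq _ _ X]mul1r.
by apply: jeqM => //; exact: jeqxx.
Qed.

(** A polynomial jet is homogenized and divided by a form [Z] that becomes 1 in the chart. *)
Let taylor_surj w : exists2 x, stalk setT p x & taylor x w.
Proof.
pose n := size (jet_poly w).
have [A hA AE] := psi_lift (jet_poly_chart w) (leqnSn n).
have [|Z hZ ZE] := psi_lift (n := n) (rpred1 _); first by rewrite size_poly1.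
have nz : ~~ on_curve Z p.
  rewrite /on_curve; suff -> : Z.@[coords p] = 1 by exact: oner_neq0.
  by apply: polyC_inj; rewrite -psi_coef0 ZE coef1.
exists (tofrac A / tofrac Z); first by exists A, Z, n; split.
exists A, Z, n; split=> //.
by rewrite ZE mul1r AE; exact: jeqxx.
Qed.

Let off_curveM H H' : ~~ on_curve H p -> ~~ on_curve H' p -> ~~ on_curve (H * H') p.
Proof. by rewrite /on_curve mevalM mulf_eq0 negb_or => -> ->. Qed.

Let taylor_lin c x y w w' : taylor x w -> taylor y w' -> taylor (cst c * x + y) (c *: w + w').
Proof.
move=> [G [H [m [hG hH nH -> E]]]] [G' [H' [m' [hG' hH' nH' -> E']]]].
exists (c *: (G * H') + G' * H), (H * H'), (m + m')%N; split.
- by apply: rpredD; [apply/rpredZ/dhomogM | rewrite addnC; apply: dhomogM].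
- exact: dhomogM.
- exact: off_curveM.
- have nzH : tofrac H != 0 :> K by rewrite tofrac_eq0 neq0_of_off_curve.
  have nzH' : tofrac H' != 0 :> K by rewrite tofrac_eq0 neq0_of_off_curve.
  rewrite -mul_mpolyC tofracD !tofracM -/(cst c).
  have fracD (L : fieldType) (c0 a b a' b' : L) : b != 0 -> b' != 0 ->
      c0 * (a / b) + a' / b' = (c0 * (a * b') + a' * b) / (b * b').
    by move=> nb nb'; field; rewrite nb nb'.
  exact: fracD nzH nzH'.
rewrite jet_poly_is_linear rmorphD /= psiZ !rmorphM /=.
have -> : psi H * psi H' * (c%:P%:P * jet_poly w + jet_poly w') =
    c%:P%:P * (psi H * jet_poly w * psi H') + psi H' * jet_poly w' * psi H.
  have alg (A : comNzRingType) (k a b u v : A) :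
      a * b * (k * u + v) = k * (a * u * b) + b * v * a by ring.
  exact: alg.
by apply: jeqD; apply: jeqM => //; try exact: jeqxx; apply: jeqM => //; exact: jeqxx.
Qed.

Let taylor_jacobian x w : taylor x w -> stalk (jacobian_ideal F) p x -> exists ab, w = syz ab.
Proof.
move=> [G [H [m [hG hH nH -> E]]]] [G1 [H1 [m1 [JG1 hG1 hH1 nH1 EF]]]].
have nzH : tofrac H != 0 :> K by rewrite tofrac_eq0 neq0_of_off_curve.
have nzH1 : tofrac H1 != 0 :> K by rewrite tofrac_eq0 neq0_of_off_curve.
have {EF} cross : psi G * psi H1 = psi G1 * psi H.
  rewrite -!rmorphM; congr (psi _); apply/eqP; rewrite -tofrac_eq !tofracM.
  by rewrite -(eqr_div _ _ nzH nzH1) EF eqxx.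
have [h ch hE] := chart_inverse D (psi_chart (H * H1)) (psi_coef0_neq0 (off_curveM nH nH1)).
have [a [b [ca cb abE]]] := jacobian_gen JG1.
have cH := psi_chart H.
(* Up to order D, [k] inverts psi H1, so [k] times the cofactors of the numerator [G1] in the
   Jacobian ideal represent [w]. *)
pose k := h * psi H.
have ck : k \is a chart by apply: rpredM.
exists (jet s (k * a), jet s (k * b)); rewrite /syz /=.
have -> : jet D (jet_poly (jet s (k * a)) * Pt + jet_poly (jet s (k * b)) * Qt)
    = jet D (k * a * Pt + k * b * Qt).
  apply: jeq_jet; apply: jeq_sym; apply: jet_syz => //; exact: rpredM.
rewrite -{1}(jet_polyK w); apply: jeq_jet.
have e1 : jeq D (jet_poly w) (psi (H * H1) * h * jet_poly w).
  by rewrite -[X in jeq _ X]mul1r; apply: jeqM; [exact: jeq_sym | exact: jeqxx].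
have e2 : jeq D (psi (H * H1) * h * jet_poly w) (h * psi H1 * psi G).
  have -> : psi (H * H1) * h * jet_poly w = h * psi H1 * (psi H * jet_poly w).
    have alg (A : comNzRingType) (x1 x2 x3 x4 : A) :
      x1 * x2 * x3 * x4 = x3 * x2 * (x1 * x4) by ring.
    by rewrite rmorphM alg.
  by apply: jeqM; [exact: jeqxx | exact: jeq_sym].
apply: jeq_trans e1 (jeq_trans e2 _).
have -> : h * psi H1 * psi G = k * psi G1.
  by rewrite -mulrA [psi H1 * _]mulrC cross [psi G1 * _]mulrC mulrA.
rewrite -(mulrA k a) -(mulrA k b) -(mulrDr k).
by apply: jeqM; [exact: jeqxx | exact: abE].
Qed.

(** The germ agrees with an element of (P, Q) up to order D, and [socle] absorbs the error after
    multiplication by a unit. The resulting exact identity in the chart lifts to homogeneous forms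
    by injectivity of [psi]. *)
Let syz_jacobian x ab : taylor x (syz ab) -> stalk (jacobian_ideal F) p x.
Proof.
case: ab => a b [G [H [m [hG hH nH -> E]]]].
pose a' := jet_poly a; pose b' := jet_poly b.
have [ca cb] : a' \is a chart /\ b' \is a chart by split; exact: jet_poly_chart.
pose j := a' * Pt + b' * Qt.
have cj : j \is a chart by apply: rpredD; apply: rpredM.
have cG := psi_chart G; have cH := psi_chart H.
have cd : psi G - psi H * j \is a chart by apply: rpredB => //; apply: rpredM.
have d0 : jeq D (psi G - psi H * j) 0.
  apply: (jeqB0 _ _ _).1; apply: jeq_trans E _.
  by apply: jeqM; [exact: jeqxx | exact: jetK].
have [d [al [be [cdd cal cbe d1 dE]]]] := socle cd d0.
pose al' := al + d * psi H * a'; pose be' := be + d * psi H * b'.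
have cal' : al' \is a chart by apply: rpredD => //; apply: rpredM => //; apply: rpredM.
have cbe' : be' \is a chart by apply: rpredD => //; apply: rpredM => //; apply: rpredM.
have dGE : d * psi G = al' * Pt + be' * Qt.
  have alg (A : comNzRingType) (x1 y1 x2 y2 k l t u : A) :
      x1 * t + y1 * u + k * (l * (x2 * t + y2 * u)) = (x1 + k * l * x2) * t + (y1 + k * l * y2) * u.
    by ring.
  by rewrite -[psi G](subrK (psi H * j)) mulrDr dE alg.
(* The lifts [Dd], [Aa], [Ab] get degrees N + e, N + m, N + m, so that both sides of [DG] have
   degree N + m + e. *)
pose N := maxn (size d) (maxn (size al') (size be')).
have leN k n : (k <= N)%N -> (k <= (N + n).+1)%N 
  by move=> lek; rewrite -addnS (leq_trans lek) ?leq_addr.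
have [ld la lb] : [/\ (size d <= N)%N, (size al' <= N)%N & (size be' <= N)%N].
  by rewrite /N !leq_max !leqnn !orbT.
have [Dd hDd DdE] := psi_lift cdd (leN _ e ld).
have [Aa hAa AaE] := psi_lift cal' (leN _ m la).
have [Ab hAb AbE] := psi_lift cbe' (leN _ m lb).
have DG : Dd * G = Aa * Fu + Ab * Fv.
  apply/eqP; rewrite -subr_eq0; apply/eqP; apply: (psi_inj (n := (N + m + e)%N)).
    apply: rpredB; first by rewrite addnAC dhomogM.
    by apply: rpredD; apply: dhomogM => //; apply: dir_homog.
  by rewrite rmorphB rmorphD !rmorphM /= DdE AaE AbE psiFu psiFv dGE subrr.
have nDd : ~~ on_curve Dd p.
  rewrite /on_curve; suff -> : Dd.@[coords p] = 1 by exact: oner_neq0.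
  by apply: polyC_inj; rewrite -psi_coef0 DdE d1.
have nzD : tofrac Dd != 0 :> K by rewrite tofrac_eq0 neq0_of_off_curve.
exists (Dd * G), (Dd * H), (N + e + m)%N; split.
- by rewrite DG; exact: jacobianFuv.
- exact: dhomogM.
- exact: dhomogM.
- exact: off_curveM.
by rewrite !tofracM -mulf_div divff // mul1r.
Qed.

Lemma tjurina_value n : tjurina_number F p n -> n = (s.+1 ^ 2)%N.
Proof.
have V0 : stalk setT p 0.
  exists 0, 1, 0; rewrite tofrac0 mul0r; split=> //; rewrite ?dhomog0 ?dhomog1 //.
  by rewrite /on_curve meval1 oner_eq0.
move/(quotient_dim_codim syz_linear syz_inj V0 taylor_ex taylor_surj taylor_lin) => /(_ _).
have -> : dim (jets s * jets s)%type = (#|{: jet_index s}| + #|{: jet_index s}|)%N.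
  by rewrite /jets -[LHS]/(#|{: jet_index s}| * 1 + #|{: jet_index s}| * 1)%N !muln1.
have -> : dim (jets D) = #|{: jet_index D}|.
  by rewrite /jets -[LHS]/(#|{: jet_index D}| * 1)%N muln1.
have := card_jet_index s; have := card_jet_index D => cD cs H.
have {}H : (n + (#|{: jet_index s}| + #|{: jet_index s}|))%N = #|{: jet_index D}|.
  apply: H => x w Tx; split; first exact: taylor_jacobian Tx.
  by move=> [ab wE]; apply: syz_jacobian (ab) _; rewrite -wE.
nia.
Qed.

End LocalTjurina.
End Tjurina.

(** * Leading form of a product of curves with distinct tangents *)

Section NormalForm.
Variable C : numClosedFieldType.
Local Notation form := {mpoly C[3]}.

(** On the curve (1, t, t^2) each nonzero linear form becomes a nonzero polynomial; take a non-root
    of their product. *)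
Lemma avoid_planes (I : finType) (P : pred I) (l : I -> 'cV[C]_3) :
  (forall i, P i -> l i != 0) -> exists v : 'rV[C]_3, forall i, P i -> (v *m l i) 0 0 != 0.
Proof.
move=> nzl; pose q i := \sum_(j < 3) l i j 0 *: 'X^j : {poly C}.
have qE i : q i = \poly_(j < 3) l i (inord j) 0.
  by rewrite poly_def; apply: eq_bigr => j _; rewrite inord_val.
have nzq i : P i -> q i != 0.
  move=> /nzl; apply: contraNneq => q0; apply/eqP/colP => j; rewrite mxE.
  by move: q0; rewrite qE => /polyP/(_ j); rewrite coef_poly ltn_ord coef0 inord_val.
have : \prod_(i | P i) q i != 0 by apply/prodf_neq0.
case/closed_nonrootP => t; rewrite rootE horner_prod => /prodf_neq0 nzt.
exists (\row_j t ^+ j) => i /nzt; rewrite /q horner_sum mxE.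
by congr (_ != 0); apply: eq_bigr => j _; rewrite hornerZ hornerXn mxE mulrC.
Qed.

(** Each curve through the point contributes one factor t and a linear factor in X whose root is its
    tangent direction. Distinct tangents give distinct roots, hence a separable leading form of
    degree [r]. *)
Lemma normal_form (I : finType) (f : I -> form) (e : I -> nat) (p0 : 'rV[C]_3) (r : nat) :
    p0 != 0 -> (forall i, f i \is (e i).-homog) -> (0 < r)%N ->
    #|[pred i | (f i).@[p0 0] == 0]| = r ->
    (forall i, (f i).@[p0 0] = 0 -> gradient (f i) p0 != 0) ->
    (forall i j, i != j -> (f i).@[p0 0] = 0 -> (f j).@[p0 0] = 0 ->
      forall c, gradient (f j) p0 != c *: gradient (f i) p0) ->
  exists B g, [/\ B \in unitmx, row 0 B = p0, blowup B (\prod_i f i) = 'X^r * g,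
    size (g`_0)%R = r.+1 & coprimep g`_0 (g`_0)^`()].
Proof.
move=> nzp hf r0 cardr nzl trl.
pose P := [pred i | (f i).@[p0 0] == 0]; pose l i := gradient (f i) p0.
have pl i : P i -> p0 *m l i = 0.
  move=> /eqP Pi; apply/matrixP => a b; rewrite !ord1 [RHS]mxE.
  by rewrite (mul_gradient _ (hf i)) Pi mul0rn.
(* With [v] off all the tangents, no tangent direction lies at X = infinity, so no degree is
   lost. *)
have [v vP] : exists v : 'rV[C]_3, forall i, P i -> (v *m l i) 0 0 != 0.
  by apply: avoid_planes => i /eqP; apply: nzl.
have [i0 Pi0] : exists i, P i by apply/existsP; rewrite -[X in is_true X]negbK negb_exists;
  apply: contraTN r0 => /forallP H; rewrite -cardr -eqn0Ngt; apply/eqP/eq_card0 => i;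
  exact: negbTE (H i).
have free a b : a *: p0 + b *: v = 0 -> a = 0 /\ b = 0.
  move=> E; have b0 : b = 0.
    move/(congr1 (fun x => (x *m l i0) 0 0)): E.
    rewrite mulmxDl -!scalemxAl (pl _ Pi0) scaler0 add0r.
    rewrite mul0mx [LHS]mxE [RHS]mxE => /eqP.
    by rewrite mulf_eq0 (negPf (vP _ Pi0)) orbF => /eqP.
  split=> //; move/eqP: E; rewrite b0 scale0r addr0 scaler_eq0 (negPf nzp) orbF.
  by move/eqP.
have [u unitB] := complete_basis3 free; set B := mx3 p0 u v in unitB.
have B0 : row 0 B = p0 by rewrite /B rowK.
have B1 : row 1 B = u by rewrite /B rowK.
have B2 : row ord_max B = v by rewrite /B rowK.
have dirE k F : (dir B k F).@[p0 0] = (row k B *m gradient F p0) 0 0.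
  rewrite /dir raddf_sum mxE; apply: eq_bigr => i _ /=.
  by rewrite mevalZ !mxE.
have coef1 i : (blowup B (f i))`_1 = ((u *m l i) 0 0)%:P + ((v *m l i) 0 0) *: 'X.
  have := congr1 (fun q : {poly {poly C}} => q`_0) (deriv_blowup B (f i)).
  rewrite coef_deriv mulr1n => ->; rewrite coefD coefCM !blowup_coef0 B0 !dirE B1 B2.
  by rewrite mulrC mul_polyC.
pose h i := if P i then drop_poly 1 (blowup B (f i)) else blowup B (f i).
have hE i : blowup B (f i) = 'X^(P i) * h i.
  rewrite /h; case: ifP => [/eqP Pi|]; last by rewrite expr0 mul1r.
  rewrite -{1}[blowup B (f i)](poly_take_drop 1) mulrC (_ : take_poly 1 _ = 0) ?add0r //.
  apply/polyP => -[|j]; rewrite coef_take_poly coef0 //=.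
  by rewrite blowup_coef0 B0 Pi polyC0.
(* The slope of the i-th tangent: u + c_i v is annihilated by the gradient. *)
pose c i := - ((u *m l i) 0 0 / (v *m l i) 0 0).
pose k i := if P i then (v *m l i) 0 0 else (f i).@[p0 0].
have nzk i : k i != 0 by rewrite /k; case: ifPn => // /vP.
have h0 i : (h i)`_0 = k i *: (if P i then 'X - (c i)%:P else 1).
  rewrite /h /k; case: ifP => Pi; last by rewrite blowup_coef0 B0 alg_polyC.
  rewrite coef_drop_poly coef1 addrC scalerBr; congr (_ + _).
  by rewrite /c polyCN scalerN opprK -mul_polyC -polyCM mulrCA divff ?mulr1 // vP.
have g0 : (\prod_i h i)`_0 =
    (\prod_i k i) *: \prod_(x <- [seq c i | i <- enum P]) ('X - x%:P).
  rewrite coef0_prod (eq_bigr _ (fun i _ => h0 i)) scaler_prod; congr (_ *: _).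
  by rewrite -big_mkcond /= big_map big_enum.
have nzK : \prod_i k i != 0 by apply/prodf_neq0.
exists B, (\prod_i h i); split=> //.
- rewrite rmorph_prod (eq_bigr _ (fun i _ => hE i)) big_split /= prodrXr; congr ('X^_ * _).
  by rewrite -cardr -sum1_card [RHS]big_mkcond; apply: eq_bigr => i _; rewrite inE; case: eqP.
- by rewrite g0 (size_scale _ nzK) size_prod_XsubC size_map -cardE cardr.
rewrite g0 derivZ (coprimepZl _ _ nzK) (coprimepZr _ _ nzK).
have := separable_prod_XsubC [seq c i | i <- enum P]; rewrite unlock => ->.
rewrite map_inj_in_uniq ?enum_uniq // => i j; rewrite !mem_enum => Pi Pj cij.
apply/eqP; apply: contraT => ne.
have xl k' : P k' -> c k' = c i -> (u + c i *: v) *m l k' = 0.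
  move=> Pk <-; apply/matrixP => a b; rewrite !ord1 mulmxDl -scalemxAl.
  rewrite [LHS]mxE [RHS]mxE [X in _ + X]mxE.
  by rewrite /c mulNr divfK ?subrr //; apply: vP.
have freeu a b : a *: p0 + b *: (u + c i *: v) = 0 -> a = 0 /\ b = 0.
  move=> E; have : (\row_j [:: a; b; b * c i]`_j) *m B = 0.
    by rewrite mul_mx3 !mxE /= -E scalerDr scalerA addrA.
  move/(canRL (mulmxK unitB)); rewrite mul0mx => /rowP E0.
  by have := E0 0; have := E0 1; rewrite !mxE.
have [k' kE] := plane_form_uniq freeu (pl i Pi) (xl i Pi erefl) (pl j Pj) (xl j Pj (esym cij))
  (nzl i (eqP Pi)).
by have := trl i j ne (eqP Pi) (eqP Pj) k'; rewrite -/(l j) kE eqxx.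
Qed.

End NormalForm.

(** * Points and incidences of an arrangement *)

Section Points.
Variable R : realType.
Local Notation C := R[i].
Local Notation form := {mpoly C[3]}.
Implicit Types (F G : form) (p q : P2 R) (v w : 'rV[C]_3).

Definition rep p : 'rV[C]_3 := vpick (val p).

Lemma rep_neq0 p : rep p != 0.
Proof.
rewrite vpick0 -dimv_eq0; have /eqP -> := valP p.
exact: oner_neq0.
Qed.

Lemma val_rep p : val p = <[rep p]>%VS.
Proof.
apply/eqP; rewrite eq_sym eqEdim -memvE memv_pick dim_vline rep_neq0.
by have /eqP -> := valP p.
Qed.

Lemma dim_vline_delta : \dim <[(delta_mx 0 0)%R : 'rV[C]_3]>%VS == 1%N.
Proof.
rewrite dim_vline; suff -> : (delta_mx 0 0 : 'rV[C]_3) != 0 by [].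
by apply/eqP => /matrixP/(_ 0 0)/eqP; rewrite !mxE !eqxx oner_eq0.
Qed.

(** The default value of [insubd] is taken only at [v = 0]. *)
Definition point v : P2 R := 
  insubd (exist (fun U : {vspace 'rV[C]_3} => \dim U == 1%N) _ dim_vline_delta : P2 R) <[v]>%VS.

Lemma val_point v : v != 0 -> val (point v) = <[v]>%VS.
Proof. by move=> nzv; rewrite insubdK // -[_ \in _]/(_ == _) dim_vline nzv. Qed.

Lemma point_rep p : point (rep p) = p.
Proof. by apply: val_inj; rewrite val_point ?rep_neq0 // -val_rep. Qed.

Lemma rep_point v : v != 0 -> exists2 c, c != 0 & rep (point v) = c *: v.
Proof.
move=> nzv; have : rep (point v) \in <[v]>%VS by rewrite -(val_point nzv) memv_pick.
case/vlineP => c cE; exists c => //; apply: contra_eq_neq cE => ->.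
by rewrite scale0r rep_neq0.
Qed.

Lemma point_eq v w : v != 0 -> w != 0 -> point v = point w -> exists c, v = c *: w.
Proof.
move=> nzv nzw /(congr1 val); rewrite !val_point // => vw.
by apply/vlineP; rewrite -vw memv_line.
Qed.

Lemma pointZ c v : c != 0 -> v != 0 -> point (c *: v) = point v.
Proof.
move=> nzc nzv; apply: val_inj; rewrite !val_point // ?scaler_eq0 ?negb_or ?nzc //.
apply/eqP; rewrite eqEdim !dim_vline nzv scaler_eq0 negb_or nzc nzv leqnn andbT.
by rewrite -memvE; apply/vlineP; exists c.
Qed.

Lemma on_curve_point F e v : F \is e.-homog -> v != 0 -> on_curve F (point v) = (F.@[v 0] == 0).
Proof.
move=> hF nzv; have [c nzc E] := rep_point nzv.
rewrite /on_curve /coords -/(rep _) E (meval_homogZ _ _ hF) mulf_eq0 expf_eq0.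
by rewrite (negPf nzc) andbF.
Qed.

Lemma tangent_lineE F p :
  tangent_line F p = [set q | (rep q *m gradient F (rep p)) 0 0 == 0].
Proof.
apply: funext => q; congr is_true; rewrite /on_curve raddf_sum mxE; congr (_ == _).
by apply: eq_bigr => i _ /=; rewrite mevalZ mevalXU mxE mulrC.
Qed.

Lemma tangent_line_eq F G p c : c != 0 ->
  gradient G (rep p) = c *: gradient F (rep p) -> tangent_line F p = tangent_line G p.
Proof.
move=> nzc E; apply: etrans (tangent_lineE F p) (etrans _ (esym (tangent_lineE G p))).
apply: (congr1 (fun f : P2 R -> bool => [set q | f q])); apply: funext => q.
by rewrite E -scalemxAr [X in _ = (X == 0)]mxE mulf_eq0 (negPf nzc).
Qed.

End Points.

(** * Singular points, intersections and incidence counts of an arrangement *)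

Section Arrangement.
Variables (R : realType) (k d : nat) (A : arrangement R k d).
Local Notation C := R[i].
Local Notation form := {mpoly C[3]}.
Local Notation eqn := (equation A).
Local Notation I := ('I_k + 'I_d)%type.
Implicit Types (s t : I) (p q : P2 R) (v : 'rV[C]_3).

Definition degree s : nat := if s is inl _ then 2 else 1.

Lemma equation_homog s : eqn s \is (degree s).-homog.
Proof. by case: s => i; [case: (conicP A i) | case: (lineP A i)]. Qed.

Lemma equation_regular s : regular (eqn s).
Proof.
move=> v nzv Fv; case: s Fv => i Fv; last first.
  by case: (lineP A i) => nzF hF; apply: gradient_linear_neq0.
have [nzF hF sm] := conicP A i; apply/eqP => g0.
suff : sing_locus (eqn (inl i)) (point v) by rewrite sm.
split=> [|j]; first by rewrite (on_curve_point hF nzv) Fv.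
rewrite (on_curve_point (dhomog_mderiv j hF) nzv).
by move/colP/(_ j): g0; rewrite !mxE => ->.
Qed.

Lemma equation_parametrization s (p0 : 'rV[C]_3) : p0 != 0 -> (eqn s).@[p0 0] = 0 ->
  exists phi, parametrization (eqn s) p0 (degree s) phi.
Proof.
case: s => i nzp Fp; last by have [nzF hF] := lineP A i; apply: line_parametrization.
by have [nzF hF _] := conicP A i; apply: (conic_parametrization hF (@equation_regular (inl i))).
Qed.

Definition incident p s := on_curve (eqn s) p.

Lemma union_homog : union_eq A \is (2 * k + d).-homog.
Proof.
have -> : (2 * k + d)%N = (\sum_s degree s)%N.
  by rewrite big_sumType /= !sum_nat_const !card_ord muln1 mulnC.
rewrite /union_eq; elim/big_rec2: _ => [|s n F _ hF]; first exact: dhomog1.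
by apply: dhomogM => //; apply: equation_homog.
Qed.

(** By the product rule, two vanishing factors kill all derivatives, while at a point of a single
    curve the gradient is a nonzero multiple of the nonzero gradient of that curve. *)
Lemma sing_locusE p : sing_locus (union_eq A) p <-> (1 < multiplicity A p)%N.
Proof.
have unionE s : union_eq A = eqn s * \prod_(t | t != s) eqn t.
  by rewrite /union_eq (bigD1 s).
have onE s q : on_curve (union_eq A) q =
    incident q s || on_curve (\prod_(t | t != s) eqn t) q.
  by rewrite (unionE s) /on_curve mevalM mulf_eq0.
split=> [[on_p dp]|lt1m]; last first.
  have [s [t [sP tP ne]]] : exists s t, [/\ incident p s, incident p t & s != t].
    by have [s [t [? ? ?]]] := card_gt1P lt1m; exists s, t; split.
  have onR : on_curve (\prod_(r | r != s) eqn r) p.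
    rewrite (bigD1 t) 1?eq_sym //= /on_curve mevalM mulf_eq0; apply/orP; left; exact: tP.
  split=> [|i]; first by rewrite (onE s) sP.
  rewrite (unionE s) mderivM /on_curve mevalD !mevalM.
  move: sP onR; rewrite /incident /on_curve => /eqP -> /eqP ->.
  by rewrite mulr0 mul0r addr0.
have [s sP] : exists s, incident p s.
  move: on_p; rewrite /on_curve /union_eq rmorph_prod /= => /prodf_eq0[s _ sP].
  by exists s.
apply/card_gt1P.
have [onR|nonR] := boolP (on_curve (\prod_(t | t != s) eqn t) p).
  move: onR; rewrite /on_curve rmorph_prod /= => /prodf_eq0[t ts tP].
  by exists s, t; rewrite eq_sym.
have /eqP[] := equation_regular (rep_neq0 p) (eqP sP).
apply/colP => i; rewrite !mxE; have := dp i; rewrite (unionE s) mderivM /on_curve mevalD !mevalM.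
rewrite (eqP sP) mul0r addr0 mulf_eq0 => /orP[/eqP //|H].
by move/negP: nonR; case.
Qed.

Lemma ordinary_gradient r p s t c : ordinary A r p -> s != t ->
  incident p s -> incident p t -> gradient (eqn t) (rep p) != c *: gradient (eqn s) (rep p).
Proof.
move=> [_ tr] st sP tP; apply/eqP => E.
have nzc : c != 0.
  apply: contra_neq (equation_regular (rep_neq0 p) (eqP tP)) => c0.
  by rewrite E c0 scale0r.
exact: tr (elimN eqP st) sP tP (tangent_line_eq nzc E).
Qed.

Lemma tjurina_ordinary r p n : ordinary A r p -> (1 < r <= 4)%N ->
  tjurina_number (union_eq A) p n -> n = (r.-1 ^ 2)%N.
Proof.
move=> ord_p /andP[r1 r4]; have [mult_p _] := ord_p.
have grad i : (eqn i).@[rep p 0] = 0 -> gradient (eqn i) (rep p) != 0.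
  exact: equation_regular (rep_neq0 p).
have trans i j : i != j -> (eqn i).@[rep p 0] = 0 -> (eqn j).@[rep p 0] = 0 ->
    forall c, gradient (eqn j) (rep p) != c *: gradient (eqn i) (rep p).
  by move=> ij /eqP iP /eqP jP c; apply: ordinary_gradient ord_p ij iP jP.
have [B [g [unitB B0 FE sg sepg]]] :=
  normal_form (rep_neq0 p) equation_homog (ltnW r1) mult_p grad trans.
move: r1 r4 FE sg => {mult_p ord_p}; case: r => [|[|s]] // _ s2 FE sg; rewrite !ltnS in s2.
have homF := union_homog.
pose Fu := dir B 1 (union_eq A); pose Fv := dir B ord_max (union_eq A).
apply: (@tjurina_value R (union_eq A) Fu Fv (2 * k + d).-1 p s (blowup B)
  (blowup B Fu) (blowup B Fv)).
- exact: chart_blowup.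
- exact: blowupZ.
- by move=> G; rewrite blowup_coef0 B0.
- exact: blowup_lift.
- exact: blowup_inj.
- exact: dir_homog.
- exact: dir_homog.
- by [].
- by [].
- move=> G H; exists (fun i => B 1 i *: G + B ord_max i *: H).
  rewrite /Fu /Fv /dir !mulr_sumr -big_split; apply: eq_bigr => i _.
  by rewrite /= mulrDl -!scalerAl -!scalerAr.
- by move=> _ [a ->]; apply: (jacobian_generated unitB homF FE s2).
- exact: (ordinary_syzygy_order FE sg sepg).
- exact: (ordinary_socle_vanishing FE sg sepg).
exact: (ordinary_jet_syzygies FE).
Qed.

Hypothesis ordA : only_ordinary_singularities A 4.

Lemma multiplicity_bounds p : sing_locus (union_eq A) p -> (1 < multiplicity A p <= 4)%N.
Proof.
move=> sp; rewrite ((sing_locusE p).1 sp) /=.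
by have [r r4 [-> _]] := ordA sp.
Qed.

Lemma ordinary_multiplicity p : sing_locus (union_eq A) p -> ordinary A (multiplicity A p) p.
Proof. by move=> /ordA[r _ op]; have [-> _] := op. Qed.

Lemma incident2_sing s t p : s != t -> incident p s -> incident p t ->
  sing_locus (union_eq A) p.
Proof. by move=> st sP tP; apply/sing_locusE/card_gt1P; exists s, t. Qed.

Lemma equation_transverse s t : s != t -> transverse (eqn s) (eqn t).
Proof.
move=> st v nzv sv tv c; apply/eqP => E.
have sP : incident (point v) s by rewrite /incident (on_curve_point (equation_homog s) nzv) sv.
have tP : incident (point v) t by rewrite /incident (on_curve_point (equation_homog t) nzv) tv.
have [k0 nzk kE] := rep_point nzv.
(* The chosen representative is k0 times [v], and a gradient scales with the degree minus one; this
   constant carries proportionality over. *)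
have := ordinary_gradient (k0 ^+ (degree t).-1 * c / k0 ^+ (degree s).-1)
  (ordinary_multiplicity (incident2_sing st sP tP)) st sP tP.
rewrite kE (gradient_homogZ _ _ (equation_homog s)) (gradient_homogZ _ _ (equation_homog t)) E.
by rewrite !scalerA divfK ?eqxx // expf_neq0.
Qed.

Lemma equation_zero s : exists2 v : 'rV[C]_3, v != 0 & (eqn s).@[v 0] = 0.
Proof.
have := equation_homog s; case dE: (degree s) => [|m]; last exact: homog_zero.
by case: s dE => i /=.
Qed.

(** Bezout's theorem with equality, by transversality. *)
Lemma pair_points s t : s != t -> exists2 X : {fset P2 R},
  #|` X| = (degree s * degree t)%N & forall p, (p \in X) = incident p s && incident p t.
Proof.
move=> st; have [vs [size_vs uniq_vs vs0 vs_inj vs_all]] :=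
  transverse_points (equation_zero s) (@equation_parametrization s) (equation_homog s)
    (@equation_regular s) (equation_homog t) (equation_transverse st).
have uniq_pt : uniq [seq point v | v <- vs].
  rewrite map_inj_in_uniq // => v w vV wV /point_eq E.
  have [c cE] := E (let: And3 h _ _ := vs0 v vV in h) (let: And3 h _ _ := vs0 w wV in h).
  exact: vs_inj vV wV c cE.
exists [fset p in [seq point v | v <- vs]]%fset.
  by rewrite card_fseq undup_id // size_map.
move=> p; rewrite inE /=; apply/mapP/andP => [[v /vs0[nzv sv tv] ->]|[sP tP]].
  rewrite /incident (on_curve_point (equation_homog s) nzv) sv.
  by rewrite (on_curve_point (equation_homog t) nzv) tv.
have [w ws [c cE]] := vs_all _ (rep_neq0 p) (eqP sP) (eqP tP).
exists w => //; have [nzw _ _] := vs0 w ws; rewrite -[p]point_rep cE pointZ //.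
by apply: contraNneq (rep_neq0 p) => c0; rewrite cE c0 scale0r.
Qed.

Hypothesis fin_sing : finite_set (sing_locus (union_eq A)).
Local Notation S := (fset_set (sing_locus (union_eq A))).

Lemma mem_sing p : (p \in S) = (1 < multiplicity A p)%N.
Proof.
rewrite in_fset_set //; apply/idP/idP => [|m1].
  by rewrite inE => /sing_locusE.
by rewrite inE; apply/sing_locusE.
Qed.

Lemma sum_incidences :
  (\sum_(p <- S) multiplicity A p * (multiplicity A p).-1 + (4 * k + d) = (2 * k + d) ^ 2)%N.
Proof.
have sq : ((2 * k + d) ^ 2 = \sum_s \sum_t degree s * degree t)%N.
  have -> : (2 * k + d)%N = (\sum_s degree s)%N.
    by rewrite big_sumType /= !sum_nat_const !card_ord muln1 mulnC.
  by rewrite -mulnn big_distrlr.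
have diag : (4 * k + d = \sum_s degree s * degree s)%N.
  by rewrite big_sumType /= !sum_nat_const !card_ord; lia.
rewrite sq diag.
have multE p : multiplicity A p = (\sum_s incident p s)%N.
  by rewrite /multiplicity -sum1_card big_mkcond; apply: eq_bigr => s _.
have pairs p : (multiplicity A p * (multiplicity A p).-1 =
    \sum_s \sum_(t | t != s) (incident p s && incident p t))%N.
  rewrite [X in (X * _)%N]multE big_distrl; apply: eq_bigr => s _ /=.
  case: (boolP (incident p s)) => sP; last by rewrite mul0n big1.
  by rewrite mul1n multE (bigD1 s) //= sP.
have pair_count s t : s != t ->
    (\sum_(p <- S) (incident p s && incident p t) = degree s * degree t)%N.
  move=> st; have [X <- memX] := pair_points st.
  pose b p := incident p s && incident p t.
  have -> : (\sum_(p <- S) b p = count b S)%N.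
    by rewrite -sum1_count [RHS]big_mkcond; apply: eq_bigr => p _; rewrite -/(b p); case: (b p).
  (* Common points of two distinct curves are singular on the union, so summing over [S] loses
     none. *)
  rewrite -size_filter; apply/perm_size/uniq_perm.
  - by apply: filter_uniq; apply: fset_uniq.
  - exact: fset_uniq.
  move=> p; rewrite mem_filter memX -/(b p); case bp: (b p) => //=.
  have /andP[sP tP] := bp; rewrite mem_sing.
  exact/sing_locusE/(incident2_sing st sP tP).
rewrite (eq_bigr _ (fun p _ => pairs p)) exchange_big /= -big_split /=.
apply: eq_bigr => s _; rewrite exchange_big /= [RHS](bigD1 s) //= addnC; congr (_ + _)%N.
by apply: eq_bigr => t ts; apply: pair_count; rewrite eq_sym.
Qed.

Lemma npoints_sum r : (1 < r)%N -> npoints A r = (\sum_(p <- S) (multiplicity A p == r))%N.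
Proof.
(* For r > 1 these points are singular, so their set is finite and [fset_set] does not take its
   default value. *)
move=> r1; have fin_r : finite_set [set p | multiplicity A p = r].
  by apply: sub_finite_set fin_sing => p /= pr; apply/sing_locusE; rewrite pr.
have -> : (\sum_(p <- S) (multiplicity A p == r) = count (fun p => multiplicity A p == r) S)%N.
  by rewrite -sum1_count [RHS]big_mkcond; apply: eq_bigr => p _; case: eqP.
rewrite -size_filter /npoints; apply/perm_size/uniq_perm.
- exact: fset_uniq.
- by apply: filter_uniq; apply: fset_uniq.
move=> p; rewrite mem_filter in_fset_set //; apply/idP/andP => [|[/eqP pr _]].
  by rewrite inE /= => pr; rewrite mem_sing pr eqxx.
by rewrite inE.
Qed.

Lemma jacobian_degree_sum D : jacobian_degree (union_eq A) D ->
  D = (\sum_(p <- S) (multiplicity A p).-1 ^ 2)%N.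
Proof.
move=> [_ [tau tauP ->]]; rewrite fsbig_finite //= big_seq [RHS]big_seq.
apply: eq_bigr => p pS; have sp : sing_locus (union_eq A) p.
  by apply/sing_locusE; rewrite -mem_sing.
exact: tjurina_ordinary (ordinary_multiplicity sp) (multiplicity_bounds sp) (tauP p sp).
Qed.

(** Pointwise, m (m - 1) = (m - 1)^2 + (m - 1), and the last term is the weight 1, 2, 3 for m = 2,
    3, 4. *)
Lemma npoints_count D : jacobian_degree (union_eq A) D ->
  (npoints A 2 + 2 * npoints A 3 + 3 * npoints A 4 + D + (4 * k + d) = (2 * k + d) ^ 2)%N.
Proof.
move=> /jacobian_degree_sum ->; rewrite -sum_incidences !npoints_sum // !big_distrr -!big_split.
congr (_ + _)%N; rewrite big_seq [RHS]big_seq; apply: eq_bigr => p pS.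
have /multiplicity_bounds : sing_locus (union_eq A) p by apply/sing_locusE; rewrite -mem_sing.
by case: (multiplicity A p) => [|[|[|[|[|]]]]].
Qed.

End Arrangement.

Theorem theorem3p1 (R : realType) (k d : nat) (A : arrangement R k d)
    (hk : (1 <= k)%N) (hd : (3 <= d)%N)
    (hA : only_ordinary_singularities A 4) (hM : M_arrangement A) :
  (forall l : nat, (2 <= l)%N -> d = (2 * l)%N ->
     (npoints A 2 + 2 * npoints A 3 + 3 * npoints A 4)%N%:Z
       = (k%:Z + l%:Z) ^+ 2 + l%:Z - k%:Z - 3)
  /\
  (forall l : nat, (1 <= l)%N -> d = (2 * l + 1)%N ->
     (npoints A 2 + 2 * npoints A 3 + 3 * npoints A 4)%N%:Z
       = (k%:Z + l%:Z) ^+ 2 + 2 * l%:Z - 1).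
Proof.
have [_ _ _ deg] := hM; have [fin_sing _] := deg.
have {deg} := npoints_count hA fin_sing deg; rewrite /M_degree.
move: (npoints A 2 + 2 * npoints A 3 + 3 * npoints A 4)%N => n count.
split=> l l1 dE; move: count; rewrite {}dE.
  (* Here m = k + l is positive, so the natural-number subtraction in [M_degree] is not
     truncated. *)
  have -> : (2 * k + 2 * l)%N = (k + l).*2 by lia.
  rewrite odd_double doubleK; nia.
have -> : (2 * k + (2 * l + 1))%N = (k + l).*2.+1 by lia.
by rewrite /= odd_double /= uphalf_double; nia.
Qed.
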